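(* Let $K\ge5$ and let $T_{1,t}(x)\in\mathrm{End}(\mathbb C^{K})^{\otimes N}$, $t\in\mathbb C$, be the analytically continued $\mathfrak{so}_K$-type transfer matrices (for the first fundamental node). Then for any $t\in\mathbb C$, $$T_{1,t}(x)=(-1)^{K}\,T_{1,2-K-t}(x).$$
   Context: $e_{ij}$ are matrix units, $\mathrm I_m$ the identity matrix, $N\ge0$ a fixed integer, $r=\lfloor K/2\rfloor$, $i'=K+1-i$ (so $1'=K$). Twist parameters: $\tau_i=e^{x_i}$, $\tau_i^s:=e^{sx_i}$, $1\le i\le r$, with $|\tau_1|>\dots>|\tau_r|>1$ (so that the traces below converge). Let $\mathcal A$ be the algebra generated by $\mathbf a_i,\bar{\mathbf a}_i$, $2\le i\le K-1$, with $[\mathbf a_i,\bar{\mathbf a}_j]=\delta_{ij}$ and other commutators of generators zero; its Fock module $\mathsf F$ has basis the monomials in the $\bar{\mathbf a}_i$ applied to $|0\rangle$, $\mathbf a_i|0\rangle=0$. Put $\bar{\mathbf w}=(\bar{\mathbf a}_2,\dots,\bar{\mathbf a}_{K-1})$, $\mathbf w=(\mathbf a_2,\dots,\mathbf a_{K-1})^T$, $\mathrm J$ the antidiagonal $(K-2)\times(K-2)$ matrix of ones, $\mathrm I=\mathrm I_{K-2}$, $u=x-1+\frac t2+\frac K4$, $v=x-\frac t2-\frac K4$, and $$\mathcal L(x)=\begin{pmatrix}1&\bar{\mathbf w}&-\frac12\bar{\mathbf w}\mathrm J\bar{\mathbf w}^T\\0&\mathrm I&-\mathrm J\bar{\mathbf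 w}^T\\0&0&1\end{pmatrix}\begin{pmatrix}u(u-\frac K2+2)&0&0\\-\mathbf wu&uv\,\mathrm I&0\\-\frac12\mathbf w^T\mathrm J\mathbf w&\mathbf w^T\mathrm Jv&v(v-\frac K2+2)\end{pmatrix}\begin{pmatrix}1&-\bar{\mathbf w}&-\frac12\bar{\mathbf w}\mathrm J\bar{\mathbf w}^T\\0&\mathrm I&\mathrm J\bar{\mathbf w}^T\\0&0&1\end{pmatrix}.$$ For $k\in\{1,\dots,r\}\cup\{r',\dots,1'\}$: $\hat B_1=\mathrm I_K$; $\hat B_k=e_{1k}+e_{k1}+e_{1'k'}+e_{k'1'}+\sum_{1<j<1',\,j\ne k,k'}e_{jj}$ for $1<k\le r$; $\hat B_k=e_{1k}+e_{k1}+e_{1'k'}+e_{k'1'}+\sum_{1<j<1',\,j\ne k,k'}e_{jj'}$ for $r'\le k<1'$; $\hat B_{1'}=\sum_je_{jj'}$. $\mathcal L_k(x)$ is $\hat B_k\mathcal L(x)\hat B_k^{-1}$ with the automorphism $\bar{\mathbf a}_j\mapsto-\mathbf a_j$, $\mathbf a_j\mapsto\bar{\mathbf a}_j$ applied for $1<j\le k$ if $k\le r$ and for $k'<j<1'$ if $k\ge r'$. Let $\mathcal F^k_{ij}$ be the coefficient of $x^1$ in $\mathcal L_k(x)_{ji}$ and $$T^+_{k,t}(x)=\mathrm{tr}_{\mathsf F}\prod_{i=1}^r\tau_i^{\mathcal F^k_{ii}}\,\underbrace{\mathcal L_k(x)\otimes\cdots\otimes\mathcal L_k(x)}_N,$$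 where $L\otimes\cdots\otimes L=\sum e_{i_1j_1}\otimes\cdots\otimes e_{i_Nj_N}L_{i_1j_1}\cdots L_{i_Nj_N}$. The analytically continued transfer matrix is, for all $t\in\mathbb C$, $T_{1,t}(x)=\sum_{k=1}^r(-1)^{k-1}T^+_{k,t}(x)+\sum_{k=1}^r(-1)^{k-1}T^+_{k',t}(x)$ if $K=2r$, and $T_{1,t}(x)=\sum_{k=1}^r(-1)^{k-1}T^+_{k,t}(x)+\sum_{k=1}^r(-1)^{k}T^+_{k',t}(x)$ if $K=2r+1$. (For $t\in\mathbb N$ it equals the transfer matrix with trace over the irreducible finite-dimensional $\mathfrak{so}_K$-module $L_{t\omega_1}$.) *)

(* Defs.v *)
From HB Require Import structures.
(* [mpoly] has to be imported before the analysis library: their notations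
   clash in the other order. *)
From mathcomp Require Import all_boot all_order all_algebra.
From mathcomp Require Import mpoly.
From mathcomp Require Import boolp classical_sets reals topology normedtype.
From mathcomp Require Import sequences exp trigo.
From mathcomp Require Import complex.
From mathcomp.analysis.showcase Require summability.

Set Implicit Arguments.
Unset Strict Implicit.
Unset Printing Implicit Defensive.

Import Order.TTheory GRing.Theory Num.Theory.
Import numFieldNormedType.Exports.

Local Open Scope classical_set_scope.
Local Open Scope ring_scope.

Definition expC (R : realType) (z : R[i]) : R[i] :=
  Complex (expR (complex.Re z) * cos (complex.Im z))
          (expR (complex.Re z) * sin (complex.Im z)).

(* Sum of a family of complex numbers, as the limit of its partial sums along
   the directed set of all finite subsets of the index set (arbitrary if the
   family is not summable). *)
Definition sumC (R : realType) (I : choiceType) (f : I -> R[i]) : R[i] :=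
  @summability.sum I R[i] (R[i])^o f.

(* The Fock module is {mpoly F[n]}: the monomial 'X_[m] is the basis vector
   \prod_j abar_j ^+ (m j) |0>.  [fockEnd F n] is the F-algebra of its linear
   endomorphisms, with composition as product. *)
Definition fockEnd (F : fieldType) (n : nat) :=
  {linear {mpoly F[n]} -> {mpoly F[n]}}.

Section FockEnd.
Variables (F : fieldType) (n : nat).
Local Notation V := {mpoly F[n]}.
Local Notation E := (fockEnd F n).
Implicit Types f g h : E.

HB.instance Definition _ := gen_eqMixin E.
HB.instance Definition _ := gen_choiceMixin E.

Lemma fockEndP f g : (forall p : V, f p = g p) -> f = g.
Proof.
move=> e; have {e} : (f : V -> V) = g by apply/funext.
case: f g => [f [[fa] [fs]]] [g [[ga] [gs]]] /= e; subst g.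
by rewrite (Prop_irrelevance fa ga) (Prop_irrelevance fs gs).
Qed.

Definition fe_zero : E := (\0 : V -> V).
Definition fe_add f g : E := (f \+ g : V -> V).
Definition fe_opp f : E := (\- f : V -> V).
Definition fe_scale (c : F) f : E := (c \*: f : V -> V).
Definition fe_one : E := (idfun : V -> V).
Definition fe_mul f g : E := (f \o g : V -> V).

Lemma fe_addA : associative fe_add.
Proof. by move=> f g h; apply: fockEndP => p /=; rewrite addrA. Qed.
Lemma fe_addC : commutative fe_add.
Proof. by move=> f g; apply: fockEndP => p /=; rewrite addrC. Qed.
Lemma fe_add0 : left_id fe_zero fe_add.
Proof. by move=> f; apply: fockEndP => p /=; rewrite add0r. Qed.
Lemma fe_addN : left_inverse fe_zero fe_opp fe_add.
Proof. by move=> f; apply: fockEndP => p /=; rewrite addNr. Qed.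

HB.instance Definition _ :=
  GRing.isZmodule.Build E fe_addA fe_addC fe_add0 fe_addN.

Lemma fe_mulA : associative fe_mul.
Proof. by move=> f g h; apply: fockEndP. Qed.
Lemma fe_mul1l : left_id fe_one fe_mul.
Proof. by move=> f; apply: fockEndP. Qed.
Lemma fe_mul1r : right_id fe_one fe_mul.
Proof. by move=> f; apply: fockEndP. Qed.
Lemma fe_mulDl : left_distributive fe_mul +%R.
Proof. by move=> f g h; apply: fockEndP. Qed.
Lemma fe_mulDr : right_distributive fe_mul +%R.
Proof. by move=> f g h; apply: fockEndP => p /=; rewrite raddfD. Qed.
Lemma fe_one_neq0 : fe_one != 0.
Proof.
apply/eqP => e; have /eqP := congr1 (fun f : E => f (1 : V)) e.
by rewrite /= oner_eq0.
Qed.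

HB.instance Definition _ := GRing.Zmodule_isNzRing.Build E
  fe_mulA fe_mul1l fe_mul1r fe_mulDl fe_mulDr fe_one_neq0.

Lemma fe_scaleA a b f : fe_scale a (fe_scale b f) = fe_scale (a * b) f.
Proof. by apply: fockEndP => p /=; rewrite scalerA. Qed.
Lemma fe_scale1 : left_id 1 fe_scale.
Proof. by move=> f; apply: fockEndP => p /=; rewrite scale1r. Qed.
Lemma fe_scaleDr : right_distributive fe_scale +%R.
Proof. by move=> a f g; apply: fockEndP => p /=; rewrite scalerDr. Qed.
Lemma fe_scaleDl f : {morph fe_scale^~ f : a b / a + b}.
Proof. by move=> a b; apply: fockEndP => p /=; rewrite scalerDl. Qed.

HB.instance Definition _ := GRing.Zmodule_isLmodule.Build F E
  fe_scaleA fe_scale1 fe_scaleDr fe_scaleDl.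

Lemma fe_scaleAl (a : F) f g : a *: (f * g) = (a *: f) * g.
Proof. by apply: fockEndP. Qed.
HB.instance Definition _ := GRing.Lmodule_isLalgebra.Build F E fe_scaleAl.

Lemma fe_scaleAr (a : F) f g : a *: (f * g) = f * (a *: g).
Proof. by apply: fockEndP => p /=; rewrite linearZ. Qed.
HB.instance Definition _ := GRing.Lalgebra_isAlgebra.Build F E fe_scaleAr.

Definition osc_a (j : 'I_n) : E := (mderiv j : V -> V).
Definition osc_abar (j : 'I_n) : E := ('X_j \*o idfun : V -> V).

Lemma osc_aA i j : osc_a i * osc_a j = osc_a j * osc_a i.
Proof. by apply: fockEndP => p /=; rewrite mderiv_comm. Qed.

Lemma osc_abarA i j : osc_abar i * osc_abar j = osc_abar j * osc_abar i.
Proof. by apply: fockEndP => p /=; rewrite mulrCA. Qed.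

Lemma osc_comm i j :
  osc_a i * osc_abar j - osc_abar j * osc_a i = (i == j)%:R.
Proof.
apply: fockEndP => p.
have -> : ((i == j)%:R : E) p = (i == j)%:R * p.
  by case: (i == j); rewrite ?mul1r ?mul0r.
rewrite /= mderivM mderivX addrK mnm1E eq_sym.
case: eqP => [->|_]; last by rewrite scale0r.
by rewrite scale1r -{1}(add0m U_(j)%MM) addmK mpolyX0.
Qed.

Lemma osc_a_vacuum i : osc_a i 1 = 0.
Proof. by rewrite /= mderivC. Qed.

End FockEnd.

Section Transfer.
Variable R : realType.
Local Notation C := R[i].

Definition fock_trace (n : nat) (O : fockEnd C n) : C :=
  sumC (fun m : 'X_{1..n} => (O 'X_[m])@_m).

(* For a diagonalizable operator H, the operator tau^H with tau = e^x, i.e. the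
   unique operator acting as tau^s = e^(s x) on the s-eigenvectors of H. *)
Definition tau_pow (n : nat) (x : C) (H : fockEnd C n) : fockEnd C n :=
  xget 0 [set G : fockEnd C n | forall (s : C) (p : {mpoly C[n]}),
            H p = s *: p -> G p = expC (s * x) *: p].

(* The index i in {1, ..., K} is represented by the element i - 1 of 'I_K, so
   that i' = K + 1 - i is rev_ord; the label j in {2, ..., K - 1} of an
   oscillator is represented by the element j - 2 of 'I_(K.-2). *)

Section Lax.
Variables (A : algType C) (K : nat) (t : C) (a abar : 'I_(K.-2) -> A).
Local Notation P := {poly A}.

Definition opcst (c : C) : P := (c%:A)%:P.

Definition lax_u : P := 'X + opcst (- 1 + t / 2%:R + K%:R / 4%:R).
Definition lax_v : P := 'X - opcst (t / 2%:R + K%:R / 4%:R).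

Definition wbar : 'rV[P]_(K.-2) := \row_j (abar j)%:P.
Definition wcol : 'cV[P]_(K.-2) := \col_j (a j)%:P.
Definition antidiag : 'M[P]_(K.-2) := \matrix_(i, j) (j == rev_ord i)%:R.

Definition block3 (M11 : 'M[P]_1) (M12 : 'rV[P]_(K.-2)) (M13 : 'M[P]_1)
    (M21 : 'cV[P]_(K.-2)) (M22 : 'M[P]_(K.-2)) (M23 : 'cV[P]_(K.-2))
    (M31 : 'M[P]_1) (M32 : 'rV[P]_(K.-2)) (M33 : 'M[P]_1) :
    'M[P]_(1 + (K.-2 + 1)) :=
  block_mx M11 (row_mx M12 M13)
           (col_mx M21 M31) (block_mx M22 M23 M32 M33).

Definition lax_blocks : 'M[P]_(1 + (K.-2 + 1)) :=
  let u := lax_u in let v := lax_v in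
  let w := wcol in let wb := wbar in let J := antidiag in
  let mhalf := opcst (- 2%:R^-1) in let k2 := opcst (K%:R / 2%:R - 2%:R) in
  block3 1%:M wb   (mhalf *: (wb *m J *m wb^T))
         0    1%:M (- (J *m wb^T))
         0    0    1%:M
  *m
  block3 (u * (u - k2))%:M             0                 0
         (- (w *m u%:M))               (u * v)%:M        0
         (mhalf *: (w^T *m J *m w))    (w^T *m J *m v%:M) (v * (v - k2))%:M
  *m
  block3 1%:M (- wb) (mhalf *: (wb *m J *m wb^T))
         0    1%:M   (J *m wb^T)
         0    0      1%:M.

(* For 2 <= K, this is a cast along 1 + (K - 2 + 1) = K. *)
Definition lax : 'M[P]_K := conform_mx 0 lax_blocks.

End Lax.

Section Twisted.
Variables (K : nat) (t : C).
Local Notation A := (fockEnd C K.-2).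

Definition idx_first (k : 'I_K) : 'I_K :=
  Ordinal (leq_ltn_trans (leq0n k) (ltn_ord k)).

(* The matrices \hat B_k, for k in {1..r} and {r'..1'}. *)
Definition Bhat (k : 'I_K) : 'M[C]_K :=
  let i1 := idx_first k in
  let k' := rev_ord k in
  let swap : 'M[C]_K := delta_mx i1 k + delta_mx k i1
              + delta_mx (rev_ord i1) k' + delta_mx k' (rev_ord i1) in
  let inner (j : 'I_K) := [&& (i1 < j)%N, (j < rev_ord i1)%N, j != k & j != k'] in
  if k == i1 then 1%:M
  else if k == rev_ord i1 then \sum_j delta_mx j (rev_ord j)
  else if (k < K./2)%N then swap + \sum_(j | inner j) delta_mx j j
  else swap + \sum_(j | inner j) delta_mx j (rev_ord j).

(* Whether the automorphism abar_j |-> - a_j, a_j |-> abar_j is applied to the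
   j-th oscillator: 1 < j <= k if k <= r, and k' < j < 1' if k >= r'. *)
Definition flipped (k : 'I_K) (j : 'I_(K.-2)) : bool :=
  if (k < K./2)%N then (1 < j.+2 <= k.+1)%N else ((rev_ord k).+1 < j.+2 < K)%N.

Definition tw_a (k : 'I_K) (j : 'I_(K.-2)) : A :=
  if flipped k j then osc_abar C j else osc_a C j.
Definition tw_abar (k : 'I_K) (j : 'I_(K.-2)) : A :=
  if flipped k j then - osc_a C j else osc_abar C j.

(* The entries of [lax] being polynomials in its generators, the automorphism
   amounts to replacing the generators by their images. *)
Definition lax_k (k : 'I_K) : 'M[{poly A}]_K :=
  map_mx (@opcst A) (Bhat k) *m lax t (tw_a k) (tw_abar k)
  *m map_mx (@opcst A) (invmx (Bhat k)).

Definition F_gen (k i j : 'I_K) : A := (lax_k k j i)`_1.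

End Twisted.

Lemma half_le (K : nat) : (K./2 <= K)%N.
Proof. by rewrite -{2}(odd_double_half K) -addnn addnA leq_addl. Qed.

Section TransferMatrix.
Variables (K N : nat) (xs : 'I_(K./2) -> C).

Definition idx (i : 'I_(K./2)) : 'I_K := widen_ord (half_le K) i.

(* End (C^K)^{\otimes N}, as matrices indexed by N-tuples of indices:
   e_{i_1 j_1} \otimes ... \otimes e_{i_N j_N} is the matrix unit with row
   (i_1, ..., i_N) and column (j_1, ..., j_N). *)
Local Notation tensorEnd := 'M[C]_(#|{: N.-tuple 'I_K}|).

Definition T_plus (k : 'I_K) (t x : C) : tensorEnd :=
  \matrix_(I, J)
    fock_trace
      ((\prod_(i < K./2) tau_pow (xs i) (F_gen t k (idx i) (idx i)))
       * \prod_(s < N)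
           (lax_k t k (tnth (enum_val I) s) (tnth (enum_val J) s)).[x%:A]).

Definition T1 (t x : C) : tensorEnd :=
  if odd K then
    \sum_(k < K./2) (-1) ^+ k *: T_plus (idx k) t x
    + \sum_(k < K./2) (-1) ^+ k.+1 *: T_plus (rev_ord (idx k)) t x
  else
    \sum_(k < K./2) (-1) ^+ k *: T_plus (idx k) t x
    + \sum_(k < K./2) (-1) ^+ k *: T_plus (rev_ord (idx k)) t x.

End TransferMatrix.
End Transfer.

(* Main.v *)
Require Import Defs.
From HB Require Import structures.
From mathcomp Require Import all_boot all_order all_algebra.
From mathcomp Require Import finmap ring lra zify.
From mathcomp Require Import mpoly.
From mathcomp Require Import boolp classical_sets reals topology normedtype.
From mathcomp Require Import sequences exp trigo.
From mathcomp Require Import complex.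
From mathcomp.analysis.showcase Require summability.

Set Implicit Arguments.
Unset Strict Implicit.
Unset Printing Implicit Defensive.

Import Order.TTheory GRing.Theory Num.Theory.
Import numFieldNormedType.Exports.

Local Open Scope ring_scope.

(** The substitution of [2 - K - t] for [t] exchanges the parameters [u] and [v]
    of the Lax matrix, and the alternating sums defining [T_{1,t}] then match
    term by term: the theorem reduces to
    [T^+_{k,t}(x) = T^+_{k',2-K-t}(x)] for [1 <= k <= r] ([T_plus_dual]).

    For fixed [k] and [t] the coefficients [F_ij] of [x^1] in [L_k(x)] satisfy
    the commutation relations of [so_K] ([so_gen_comm]), and the whole Lax matrix
    is a polynomial in them,
    [L_k(x) = x^2 + x F + (1/2) F^2 + e F + d], where only the scalar [d]
    depends on [t], and [d] is invariant under [t |-> 2 - K - t] ([lax_horner]).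
    So an entry of [T^+_{k,t}] and the corresponding entry of [T^+_{k',2-K-t}]
    are twisted traces [X |-> tr (G X)] of one and the same noncommutative
    polynomial, evaluated at the generators [F_ij] and [F'_ij] of two
    representations of [so_K] on the same Fock module.  The diagonal generators
    of the two representations are the same operators ([cartan_same]), hence so
    is [G], the product of the [tau_i^(F_ii)].

    For special values of [t] the two representations need not be isomorphic, so
    no intertwiner is used.  Instead, a twisted trace is determined by its values
    on the diagonal generators ([gtrace_word_eq]).  Indeed
    [G F_ij = c_ij F_ij G] for a scalar [c_ij], and [c_ij <> 1] for [i <> j]
    because [|tau_1| > ... > |tau_r| > 1].  Consider a word in the [F_ij].
    Permuting its letters changes it by a combination of shorter words.  By
    cyclicity of the trace, moving a letter [F_ij] from the end of the word to its
    beginning multiplies the trace by [c_ij]; if [i <> j], comparing both facts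
    expresses the trace through traces of shorter words, in the same way for both
    representations.  A word in diagonal letters is the same operator in both.

    The traces are infinite sums.  The moduli of the eigenvalues of [G] on
    monomials decay geometrically with the degree ([gibbs_decays]), whereas an
    oscillator changes a monomial into a multiple of a neighbouring monomial, with
    a factor bounded by the degree.  So all series converge absolutely, and
    cyclicity for one oscillator is a shift of the summation index
    ([fock_trace_cyclic]). *)

(** * Absolutely summable families of complex numbers *)

Section ComplexModulus.
Variable R : realType.
Local Notation C := R[i].
Implicit Types z w : C.

(** The norm of [R[i]] is complex-valued; a real-valued modulus gives access to
    the total order of [R] in estimates. *)
Definition cabs z : R := complex.Re `|z|.

Lemma normC_cabs z : `|z| = (cabs z)%:C%C.
Proof. by rewrite /cabs normc_def. Qed.

Lemma cabs_ge0 z : 0 <= cabs z.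
Proof. by rewrite -ler0c -normC_cabs. Qed.

Lemma cabs0 : cabs 0 = 0.
Proof. by rewrite /cabs normr0. Qed.

Lemma cabsM z w : cabs (z * w) = cabs z * cabs w.
Proof. by apply: complexI; rewrite rmorphM -!normC_cabs normrM. Qed.

Lemma cabsN z : cabs (- z) = cabs z.
Proof. by rewrite /cabs normrN. Qed.

Lemma cabs_nat (k : nat) : cabs k%:R = k%:R.
Proof. by apply: complexI; rewrite -normC_cabs normr_nat rmorph_nat. Qed.

Lemma ler_norm_Re z : `|complex.Re z| <= cabs z.
Proof. by rewrite -lecR -normC_cabs; exact: normc_ge_Re. Qed.

Lemma ler_norm_Im z : `|complex.Im z| <= cabs z.
Proof.
have -> : complex.Im z = complex.Re (- ('i%C * z)).
  by case: z => a b /=; rewrite !mul0r mul1r sub0r opprK.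
apply: le_trans (ler_norm_Re _) _; rewrite cabsN cabsM.
suff -> : cabs 'i%C = 1 by rewrite mul1r.
by rewrite /cabs normc_def /= expr0n /= add0r expr1n sqrtr1.
Qed.

Lemma cabs_real (x : R) : cabs x%:C%C = `|x|.
Proof. by rewrite /cabs normc_def /= expr0n addr0 sqrtr_sqr. Qed.

End ComplexModulus.

Section AbsolutelySummable.
Variable R : realType.
Local Notation C := R[i].
Local Open Scope classical_set_scope.
Local Open Scope fset_scope.

Local Notation psum := summability.partial_sum.
Local Notation totally := summability.totally.
#[local] Existing Instance summability.totally_filter.

Definition abs_summable (I : choiceType) (f : I -> C) : Prop :=
  exists B : R, forall A : {fset I}, \sum_(i <- A) cabs (f i) <= B.

Definition has_sum (I : choiceType) (f : I -> C) (l : C) : Prop :=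
  psum (R := C) f A @[A --> totally] --> (l : C^o).

Lemma has_sum_sumC (I : choiceType) (f : I -> C) l : has_sum f l -> sumC f = l.
Proof.
move=> h; rewrite /sumC /summability.sum.
exact: (@cvg_lim C^o (@norm_hausdorff C C^o)).
Qed.

Lemma psumE (I : choiceType) (V : zmodType) (f : I -> V) (A : {fset I}) :
  psum f A = (\sum_(i <- A) f i)%R.
Proof. by rewrite /summability.partial_sum big_seq_fsetE. Qed.

(** The net of partial sums is nondecreasing along finite sets, so it converges to
    its supremum. *)
Lemma psum_nneg_cvg (I : choiceType) (u : I -> R) (B : R) :
  (forall i, 0 <= u i)%R ->
  (forall A : {fset I}, \sum_(i <- A) u i <= B)%R ->
  exists l : R, psum u A @[A --> totally] --> l.
Proof.
move=> u0 uB.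
pose S := [set s | exists A : {fset I}, s = (\sum_(i <- A) u i)%R]%classic.
have hS : has_sup S.
  split; first by exists (\sum_(i <- (fset0 : {fset I})) u i)%R, fset0.
  by exists B => _ [A ->].
exists (sup S); apply/cvgrPdist_lt => e e0.
have [_ [A ->] hA] := sup_adherent e0 hS.
exists A => // D /= AD; rewrite psumE.
have le1 : (\sum_(i <- A) u i <= \sum_(i <- D) u i)%R.
  rewrite (big_fsetID _ (mem A) D) /=.
  have -> : [fset x in D | x \in A] = A.
    apply/fsetP => x; rewrite !inE /= andbC; case xA: (x \in A) => //=.
    by rewrite (fsubsetP AD).
  by rewrite lerDl sumr_ge0.
have le2 : (\sum_(i <- D) u i <= sup S)%R by apply: ub_le_sup; [case: hS|exists D].
rewrite ger0_norm ?subr_ge0 //; lra.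
Qed.

Lemma real_complex_cvg (T : Type) (F : set_system T) (FF : Filter F)
    (u : T -> R) (l : R) :
  u x @[x --> F] --> l -> (u x)%:C%C @[x --> F] --> (l%:C%C : C^o).
Proof.
move=> /(@cvgrPdist_lt R R^o T F FF u l) h.
apply/(@cvgrPdist_lt C C^o T F FF) => -[e e'] e0.
have [e1 e2] : e' = 0%R /\ (0 < e)%R by move: e0; rewrite ltcE /= => /andP[/eqP].
apply: filterS (h _ e2) => x hx.
by rewrite e1 -rmorphB [X in (X < _)%R]normC_cabs cabs_real ltcR.
Qed.

(** Convergence is reduced to that of real sums of nonnegative terms: the real part [g]
    of a term is the difference of the nonnegative [g + |g|] and [|g|], both with bounded partial sums, and so is the imaginary part. *)
Lemma abs_summable_has_sum (I : choiceType) (f : I -> C) :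
  abs_summable f -> exists l, has_sum f l.
Proof.
move=> [B hB].
have re_cvg (g : I -> R) : (forall i, `|g i| <= cabs (f i))%R ->
    exists l : R, psum g A @[A --> totally] --> l.
  move=> hg.
  have hgB (A : {fset I}) : (\sum_(i <- A) `|g i| <= B)%R.
    by apply: le_trans (hB A); apply: ler_sum => i _; exact: hg.
  have [|A|l hl] := @psum_nneg_cvg I (fun i => `|g i|)%R B => //.
  have [|A|k hk] := @psum_nneg_cvg I (fun i => g i + `|g i|)%R (B + B)%R.
  - by move=> i; rewrite -lerBlDr sub0r lerNl -normrN ler_norm.
  - rewrite big_split /= lerD //; apply: le_trans (hgB A).
    by apply: ler_sum => i _; exact: ler_norm.
  exists (k - l)%R.
  suff -> : psum g = ((psum (fun i => g i + `|g i|) \- psum (fun i => `|g i|)))%R.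
    exact: (@cvgB R R^o).
  apply/funext => A; rewrite /= !psumE big_split /=; lra.
have [a ha] := re_cvg _ (fun i => ler_norm_Re (f i)).
have [b hb] := re_cvg _ (fun i => ler_norm_Im (f i)).
exists (a%:C%C + 'i%C * b%:C%C)%R; rewrite /has_sum.
suff -> : psum (R := C) f = ((fun A => (psum (fun i => complex.Re (f i)) A)%:C%C)
    \+ 'i%C \*: (fun A => (psum (fun i => complex.Im (f i)) A)%:C%C : C^o))%R.
  apply: (@cvgD _ C^o); first exact: real_complex_cvg.
  by apply: (@cvgZr _ C^o); exact: real_complex_cvg.
apply/funext => A; rewrite /= !psumE !rmorph_sum /= /GRing.scale /=.
rewrite mulr_sumr -big_split /=; apply: eq_bigr => i _.
by rewrite -complexE.
Qed.

Lemma has_sumD (I : choiceType) (f g : I -> C) k l :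
  has_sum f k -> has_sum g l -> has_sum (fun i => f i + g i)%R (k + l)%R.
Proof.
move=> hf hg; rewrite /has_sum.
suff -> : psum (R := C) (fun i => f i + g i)%R = (psum (R := C) f \+ psum (R := C) g)%R.
  exact: (@cvgD C C^o _ totally _ _ _ _ _ hf hg).
by apply/funext => A; rewrite /= !psumE big_split.
Qed.

Lemma has_sumZ (I : choiceType) (f : I -> C) c l :
  has_sum f l -> has_sum (fun i => c * f i)%R (c * l)%R.
Proof.
move=> hf; rewrite /has_sum.
suff -> : psum (R := C) (fun i => c * f i)%R = (c \*: (psum f : _ -> C^o))%R.
  exact: (@cvgZr C C^o _ totally _ c _ _ hf).
by apply/funext => A; rewrite /= !psumE /GRing.scale /= mulr_sumr.
Qed.

Lemma has_sum_reindex (I J : choiceType) (s : I -> J) (r : J -> I)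
    (f : J -> C) l :
  cancel s r -> (forall j, s (r j) != j -> f j = 0%R) ->
  has_sum f l -> has_sum (fun i => f (s i)) l.
Proof.
move=> sK f0 hf U /hf [A0 _ hA0].
(* Indices of [A0] outside the image of [s] do not contribute, and the others
   are images of elements of [A]. *)
exists [fset r j | j in A0] => // A /= sA.
have -> : psum (R := C) (fun i => f (s i)) A = psum f (A0 `|` s @` A).
  rewrite !psumE; transitivity (\sum_(j <- s @` A) f j)%R.
    by rewrite big_imfset //= => x y _ _ /(can_inj sK).
  apply: big_fset_incl; first exact: fsubsetUr.
  move=> j; rewrite inE => /orP[jA0|->//] jsA; apply: f0.
  apply: contra jsA => /eqP <-; apply: in_imfset.
  by apply: (fsubsetP sA); exact: in_imfset.
by apply: hA0; exact: fsubsetUl.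
Qed.

End AbsolutelySummable.

Section GeometricSeries.
Variable R : realType.

(** A finite set of multi-indices lies in a cube, over which the sum is a product
    of [n] geometric sums. *)
Lemma geom_multinom_bound (n : nat) (r : R) : 0 < r < 1 ->
  exists B : R, forall A : {fset 'X_{1..n}}, \sum_(m <- A) r ^+ mdeg m <= B.
Proof.
move=> /andP[r0 r1]; exists ((1 - r)^-1 ^+ n) => A.
(* [D] bounds all exponents of the multi-indices in [A]. *)
pose D := (\sum_(m <- A) mdeg m).+1.
pose phi (f : {ffun 'I_n -> 'I_D}) : 'X_{1..n} := [multinom (f i : nat) | i < n].
have phi_inj : injective phi.
  move=> f g /mnmP e; apply/ffunP => i; apply: val_inj.
  by have := e i; rewrite !mnmE.
pose s := [seq phi f | f : {ffun 'I_n -> 'I_D}].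
have AE : perm_eq A [seq m <- s | m \in A].
  apply: uniq_perm; first exact: fset_uniq.
    by rewrite filter_uniq // map_inj_uniq // enum_uniq.
  move=> m; rewrite mem_filter; apply/idP/idP => [mA|/andP[]//].
  have hm i : (m i < D)%N.
    rewrite ltnS /D (big_fsetD1 m) //=; apply: leq_trans (leq_addr _ _).
    by rewrite mdegE (bigD1 i) //= leq_addr.
  rewrite mA /=; have -> : m = phi [ffun i => Ordinal (hm i)].
    by apply/mnmP => i; rewrite mnmE ffunE.
  by rewrite map_f // mem_enum.
rewrite (perm_big _ AE) /= big_filter.
apply: (@le_trans _ _ (\sum_(m <- s) r ^+ mdeg m)).
  rewrite [leRHS](bigID (mem A)) /= lerDl sumr_ge0 // => m _.
  by rewrite exprn_ge0 ?ltW.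
rewrite big_image /=.
have -> : \sum_(f : {ffun 'I_n -> 'I_D}) r ^+ mdeg (phi f) =
          \prod_(i < n) \sum_(k < D) r ^+ k.
  rewrite bigA_distr_bigA /=; apply: eq_bigr => f _.
  rewrite mdegE -prodrXr; apply: eq_bigr => i _.
  by rewrite mnmE.
rewrite prodr_const card_ord; apply: lerXn2r; rewrite ?nnegrE.
- by rewrite sumr_ge0 // => k _; rewrite exprn_ge0 ?ltW.
- by rewrite invr_ge0 subr_ge0 ltW.
rewrite -div1r ler_pdivlMr ?subr_gt0 // mulrC -[1 - r]opprB mulNr -subrX1 opprB.
by rewrite lerBlDr lerDl exprn_ge0 ?ltW.
Qed.

(** A linear factor is absorbed by replacing [r] with the mean of [r] and [1], by
    Bernoulli's inequality.  Thanks to this, no polynomial factors have to be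
    carried along in the estimates. *)
Lemma linear_times_geom (r : R) (d : nat) : 0 < r < 1 ->
  exists s K : R, [/\ 0 < s < 1, 0 <= K &
    forall k : nat, (k + d)%:R * r ^+ k <= K * s ^+ k].
Proof.
move=> /andP[r0 r1]; pose s := (1 + r) / 2%:R; pose q := s / r.
have q1 : 1 < q by rewrite ltr_pdivlMr // /s; lra.
exists s, ((q - 1)^-1 + d%:R); split; first by rewrite /s; lra.
  by rewrite addr_ge0 ?ler0n // invr_ge0 subr_ge0 ltW.
move=> k; have -> : s = q * r by rewrite divfK ?gt_eqF.
rewrite exprMn mulrA ler_wpM2r ?exprn_ge0 ?(ltW r0) //.
have bernoulli : 1 + k%:R * (q - 1) <= q ^+ k.
  elim: k => [|k IHk]; first by rewrite mul0r addr0.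
  rewrite exprS; apply: (@le_trans _ _ (q * (1 + k%:R * (q - 1)))).
    rewrite -natr1; have : 0 <= k%:R * (q - 1) * (q - 1).
      by rewrite !mulr_ge0 ?subr_ge0 ?(ltW q1).
    lra.
  by rewrite ler_pM2l // (lt_trans ltr01).
have q1V : (q - 1)^-1 * (q - 1) = 1 by rewrite mulVf // subr_eq0 gt_eqF.
apply: (@le_trans _ _ (((q - 1)^-1 + d%:R) * (1 + k%:R * (q - 1)))).
  rewrite natrD.
  have : 0 <= (q - 1)^-1 by rewrite invr_ge0 subr_ge0 ltW.
  have : 0 <= d%:R * (k%:R * (q - 1)) by rewrite !mulr_ge0 ?subr_ge0 ?(ltW q1).
  have : (q - 1)^-1 * (k%:R * (q - 1)) = k%:R by rewrite mulrCA q1V mulr1.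
  lra.
by rewrite ler_wpM2l // addr_ge0 ?ler0n // invr_ge0 subr_ge0 ltW.
Qed.

End GeometricSeries.

(** * Convergent traces on the Fock module and their cyclicity *)

Section TraceClass.
Variables (R : realType) (n : nat).
Local Notation C := R[i].
Local Notation E := (fockEnd C n).
Implicit Types (X Y Z : E) (m : 'X_{1..n}).

Definition diag Z m : C := (Z 'X_[m])@_m.

(** This class of operators is stable under the oscillators on both sides; the
    bound on the degree of the image monomial is what controls the factor produced by an annihilation operator on the left. *)
Definition decaying_monomial Z : Prop :=
  exists (r B : R) (d : nat), [/\ 0 < r < 1, 0 <= B &
    forall m, exists c m', [/\ Z 'X_[m] = c *: 'X_[m'],
      cabs c <= B * r ^+ mdeg m & (mdeg m' <= mdeg m + d)%N]].

(** Only monomial operators are estimated directly; passing to their span makes the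
    trace a linear functional. *)
Inductive trace_class : E -> Prop :=
| TraceMonomial Z : decaying_monomial Z -> trace_class Z
| TraceAdd Y Z : trace_class Y -> trace_class Z -> trace_class (Y + Z)
| TraceScale c Z : trace_class Z -> trace_class (c *: Z).

Lemma fe_mulE X Y p : (X * Y) p = X (Y p). Proof. by []. Qed.
Lemma fe_addE X Y p : (X + Y) p = X p + Y p. Proof. by []. Qed.
Lemma fe_scaleE c X p : (c *: X) p = c *: X p. Proof. by []. Qed.
Lemma osc_aE (j : 'I_n) (p : {mpoly C[n]}) : osc_a C j p = mderiv j p. Proof. by []. Qed.
Lemma osc_abarE (j : 'I_n) (p : {mpoly C[n]}) : osc_abar C j p = 'X_j * p. Proof. by []. Qed.

Lemma osc_aX j m : osc_a C j 'X_[m] = (m j)%:R *: 'X_[m - U_(j)].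
Proof. by rewrite osc_aE mderivX. Qed.

Lemma osc_abarX j m : osc_abar C j 'X_[m] = 'X_[m + U_(j)].
Proof. by rewrite osc_abarE -mpolyXD addmC. Qed.

Lemma decaying_monomial_diag Z : decaying_monomial Z -> abs_summable (diag Z).
Proof.
move=> [r [B [d [r01 B0 h]]]].
have [B' hB'] := @geom_multinom_bound R n r r01.
exists (B * B') => A; apply: le_trans (ler_wpM2l B0 (hB' A)).
rewrite mulr_sumr; apply: ler_sum => m _.
have [c [m' [e hc _]]] := h m; apply: le_trans hc.
rewrite /diag e mcoeffZ mcoeffX cabsM cabs_nat.
by case: eqP => _; rewrite ?mulr1 // mulr0 cabs_ge0.
Qed.

Lemma trace_class_has_sum Z : trace_class Z -> has_sum (diag Z) (fock_trace Z).
Proof.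
suff h : trace_class Z -> exists l, has_sum (diag Z) l.
  by move=> /h [l hl]; rewrite /fock_trace (has_sum_sumC hl).
elim=> [{}Z /decaying_monomial_diag/abs_summable_has_sum //||].
- move=> {}Y {}Z _ [k hk] _ [l hl]; exists (k + l).
  have -> : diag (Y + Z) = (fun m => diag Y m + diag Z m).
    by apply/funext => m; rewrite /diag fe_addE mcoeffD.
  exact: has_sumD.
- move=> c {}Z _ [l hl]; exists (c * l).
  have -> : diag (c *: Z) = (fun m => c * diag Z m).
    by apply/funext => m; rewrite /diag fe_scaleE mcoeffZ.
  exact: has_sumZ.
Qed.

Lemma fock_traceD Y Z : trace_class Y -> trace_class Z ->
  fock_trace (Y + Z) = fock_trace Y + fock_trace Z.
Proof.
move=> /trace_class_has_sum hY /trace_class_has_sum hZ; apply: has_sum_sumC.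
have := has_sumD hY hZ; congr has_sum.
by apply/funext => m; rewrite fe_addE mcoeffD.
Qed.

Lemma fock_traceZ c Z : trace_class Z ->
  fock_trace (c *: Z) = c * fock_trace Z.
Proof.
move=> /trace_class_has_sum hZ; apply: has_sum_sumC.
have := has_sumZ (c := c) hZ; congr has_sum.
by apply/funext => m; rewrite fe_scaleE mcoeffZ.
Qed.

Lemma decaying_osc_a_l j Z :
  decaying_monomial Z -> decaying_monomial (osc_a C j * Z).
Proof.
move=> [r [B [d [r01 B0 h]]]].
have [s [K [s01 K0 hK]]] := linear_times_geom d r01.
exists s, (B * K), d; split; rewrite ?mulr_ge0 // => m.
have [c [m' [e hc hm']]] := h m.
exists (c * (m' j)%:R), (m' - U_(j))%MM; split.
- by rewrite fe_mulE e linearZ /= mderivX scalerA.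
- rewrite cabsM cabs_nat -mulrA.
  apply: (@le_trans _ _ (B * ((mdeg m + d)%:R * r ^+ mdeg m))).
    rewrite (mulrC _%:R) mulrA ler_pM ?cabs_ge0 // ler_nat.
    by apply: leq_trans hm'; rewrite mdegE (bigD1 j) //= leq_addr.
  by rewrite ler_wpM2l.
- exact: leq_trans (mdegB _ _) hm'.
Qed.

Lemma decaying_osc_abar_l j Z :
  decaying_monomial Z -> decaying_monomial (osc_abar C j * Z).
Proof.
move=> [r [B [d [r01 B0 h]]]]; exists r, B, d.+1; split=> // m.
have [c [m' [e hc hm']]] := h m; exists c, (m' + U_(j))%MM; split=> //.
  by rewrite fe_mulE e linearZ -osc_abarX.
by rewrite mdegD mdeg1 addn1 addnS ltnS.
Qed.

Lemma decaying_osc_a_r j Z :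
  decaying_monomial Z -> decaying_monomial (Z * osc_a C j).
Proof.
move=> [r [B [d [r01 B0 h]]]].
have [s [K [s01 K0 hK]]] := linear_times_geom 0 r01.
have r0 : 0 < r by case/andP: r01.
exists s, (B / r * K), d.
have BK0 : 0 <= B / r * K by rewrite !mulr_ge0 // invr_ge0 ltW.
split=> // m.
have [c [m' [e hc hm']]] := h (m - U_(j))%MM.
have [mj0|mj0] := eqVneq (m j) 0%N.
  exists 0, m; rewrite fe_mulE osc_aX mj0 !scale0r linear0 cabs0 leq_addr.
  by split=> //; rewrite mulr_ge0 // exprn_ge0 // ltW //; case/andP: s01.
have dm : mdeg (m - U_(j)) = (mdeg m).-1.
  by rewrite -{2}(submK (m := U_(j)) (m' := m)) ?lep1mP // mdegD mdeg1 addn1.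
have dm0 : (0 < mdeg m)%N by rewrite mdegE (bigD1 j) //= addn_gt0 lt0n mj0.
exists ((m j)%:R * c), m'; split.
- by rewrite fe_mulE osc_aX linearZ /= e scalerA.
- rewrite cabsM cabs_nat -mulrA.
  apply: (@le_trans _ _ (B / r * ((mdeg m + 0)%:R * r ^+ mdeg m))).
    rewrite addn0 mulrCA ler_pM ?cabs_ge0 //.
      by rewrite ler_nat mdegE (bigD1 j) //= leq_addr.
    apply: le_trans hc _; rewrite dm -{2}(prednK dm0) exprS mulrA divfK //.
    by rewrite gt_eqF.
  by rewrite ler_wpM2l // mulr_ge0 // invr_ge0 ltW.
- by apply: leq_trans hm' _; rewrite dm leq_add2r leq_pred.
Qed.

Lemma decaying_osc_abar_r j Z :
  decaying_monomial Z -> decaying_monomial (Z * osc_abar C j).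
Proof.
move=> [r [B [d [r01 B0 h]]]]; exists r, B, d.+1; split=> // m.
have [c [m' [e hc hm']]] := h (m + U_(j))%MM; exists c, m'; split.
- by rewrite fe_mulE osc_abarX.
- apply: le_trans hc _; rewrite mdegD mdeg1 addn1 exprS ler_wpM2l //.
  have /andP[r0 r1] := r01.
  by rewrite -[leRHS]mul1r ler_wpM2r ?exprn_ge0 ?ltW.
- by move: hm'; rewrite mdegD mdeg1 addn1 addSnnS.
Qed.

Inductive weyl : E -> Prop :=
| WeylOne : weyl 1
| WeylA j : weyl (osc_a C j)
| WeylAbar j : weyl (osc_abar C j)
| WeylAdd X Y : weyl X -> weyl Y -> weyl (X + Y)
| WeylMul X Y : weyl X -> weyl Y -> weyl (X * Y)
| WeylScale c X : weyl X -> weyl (c *: X).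

Lemma trace_class_stable (f : E -> E) :
  {morph f : Y Z / Y + Z} -> scalable f ->
  (forall Z, decaying_monomial Z -> decaying_monomial (f Z)) ->
  forall Z, trace_class Z -> trace_class (f Z).
Proof.
move=> fD fZ hf Z; elim=> [{}Z hZ|{}Y {}Z _ hY _ hZ|c {}Z _ hZ].
- by apply: TraceMonomial; exact: hf.
- by rewrite fD; exact: TraceAdd.
- by rewrite fZ; exact: TraceScale.
Qed.

Lemma trace_class_mull X :
  (forall Z, decaying_monomial Z -> decaying_monomial (X * Z)) ->
  forall Z, trace_class Z -> trace_class (X * Z).
Proof.
apply: (trace_class_stable (f := fun Z => X * Z)) => [Y Z|c Z].
  exact: mulrDr.
by rewrite scalerAr.
Qed.

Lemma trace_class_mulr X :
  (forall Z, decaying_monomial Z -> decaying_monomial (Z * X)) ->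
  forall Z, trace_class Z -> trace_class (Z * X).
Proof.
apply: (trace_class_stable (f := fun Z => Z * X)) => [Y Z|c Z].
  exact: mulrDl.
by rewrite scalerAl.
Qed.

Lemma weyl_trace_class X Z :
  weyl X -> trace_class Z -> trace_class (X * Z) /\ trace_class (Z * X).
Proof.
move=> wX; elim: wX Z => [|j|j|{}X Y _ hX _ hY|{}X Y _ hX _ hY|c {}X _ hX] Z tZ.
- by rewrite mul1r mulr1.
- split; first by apply: trace_class_mull tZ => ?; exact: decaying_osc_a_l.
  by apply: trace_class_mulr tZ => ?; exact: decaying_osc_a_r.
- split; first by apply: trace_class_mull tZ => ?; exact: decaying_osc_abar_l.
  by apply: trace_class_mulr tZ => ?; exact: decaying_osc_abar_r.
- have [? ?] := hX _ tZ; have [? ?] := hY _ tZ.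
  by rewrite mulrDl mulrDr; split; exact: TraceAdd.
- by rewrite -(mulrA X) (mulrA Z); split; [apply: (hX _ (hY _ tZ).1).1|
                                   apply: (hY _ (hX _ tZ).2).2].
- have [? ?] := hX _ tZ.
  by rewrite -scalerAl -scalerAr; split; exact: TraceScale.
Qed.

Lemma mcoeff_mulXU j (p : {mpoly C[n]}) m : m j = 0%N -> ('X_j * p)@_m = 0.
Proof.
move=> mj; rewrite [p]mpolyE mulr_sumr raddf_sum big1 // => k _.
rewrite /= -scalerAr mcoeffZ -mpolyXD mcoeffX; case: eqP => [e|_]; last by rewrite mulr0.
by move: mj; rewrite -e mnmDE mnm1E eqxx.
Qed.

(** The form that cyclicity takes for a single oscillator [j]: the two diagonals
    differ by a shift of the [j]-th exponent. *)
Lemma fock_trace_shift (j : 'I_n) Y Z : trace_class Z ->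
  (forall m, m j = 0%N -> diag Z m = 0) ->
  (forall m, diag Y m = diag Z (m + U_(j))) -> fock_trace Y = fock_trace Z.
Proof.
move=> /trace_class_has_sum hZ Z0 YZ; apply: has_sum_sumC.
have := has_sum_reindex (s := fun m => (m + U_(j))%MM) (r := fun m => (m - U_(j))%MM)
  (fun m => addmK _ _) _ hZ.
rewrite (_ : (fun i => diag Z (i + U_(j))) = diag Y); last by apply/funext.
apply=> m; case: (eqVneq (m j) 0%N) => [/Z0 //|mj].
by rewrite submK ?eqxx // lep1mP.
Qed.

(** Cyclicity in the first factor is inherited by sums and products, so it is
    enough to know it for one oscillator. *)
Lemma fock_trace_cyclic X Z : weyl X -> trace_class Z ->
  fock_trace (X * Z) = fock_trace (Z * X).
Proof.
move=> wX; elim: wX Z => [|j|j|{}X Y wX hX wY hY|{}X Y wX hX wY hY|c {}X wX hX] Z tZ.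
- by rewrite mul1r mulr1.
- apply: (fock_trace_shift (j := j)) => [|m mj|m].
  + by case: (weyl_trace_class (WeylA j) tZ).
  + by rewrite /diag fe_mulE osc_aX mj scale0r linear0 mcoeff0.
  + rewrite /diag !fe_mulE osc_aX addmK osc_aE mcoeff_deriv linearZ mcoeffZ.
    by rewrite mnmDE mnm1E eqxx addn1 mulr_natl.
- apply/esym/(fock_trace_shift (j := j)) => [|m mj|m].
  + by case: (weyl_trace_class (WeylAbar j) tZ).
  + by rewrite /diag fe_mulE osc_abarE mcoeff_mulXU.
  + by rewrite /diag !fe_mulE osc_abarX osc_abarE mulrC addmC mcoeffMX addmC.
- have [? ?] := weyl_trace_class wX tZ; have [? ?] := weyl_trace_class wY tZ.
  by rewrite mulrDl mulrDr !fock_traceD // hX // hY.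
- have [? ?] := weyl_trace_class wX tZ; have [? ?] := weyl_trace_class wY tZ.
  by rewrite -mulrA hX // -mulrA hY // mulrA.
- have [? ?] := weyl_trace_class wX tZ.
  by rewrite -scalerAl -scalerAr !fock_traceZ // hX.
Qed.

End TraceClass.

(** * Linear identities between noncommutative monomials *)

(** In a noncommutative algebra, an identity between linear combinations of
    monomials holds as soon as the coefficients of each monomial agree.  The
    tactic [lmod_with S] replaces such an identity by these equalities of
    coefficients in [S], which commutative tactics can prove; everything that is
    not a sum, an opposite or a multiple counts as a monomial. *)
Inductive lexpr (S : Type) :=
| LVar of nat | LZero | LAdd of lexpr S & lexpr S | LOpp of lexpr S
| LScale of S & lexpr S.

Section LinearReflection.
Variables (S : comNzRingType) (V : lmodType S).

Fixpoint leval (env : seq V) (e : lexpr S) : V :=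
  match e with
  | LVar i => nth 0 env i
  | LZero => 0
  | LAdd e1 e2 => leval env e1 + leval env e2
  | LOpp e1 => - leval env e1
  | LScale c e1 => c *: leval env e1
  end.

Fixpoint lcoef (i : nat) (e : lexpr S) : S :=
  match e with
  | LVar j => if eqn i j then 1 else 0
  | LZero => 0
  | LAdd e1 e2 => lcoef i e1 + lcoef i e2
  | LOpp e1 => - lcoef i e1
  | LScale c e1 => c * lcoef i e1
  end.

Lemma levalE env e : leval env e = \sum_(i < size env) lcoef i e *: nth 0 env i.
Proof.
elim: e => [j||e1 IH1 e2 IH2|e1 IH1|c e1 IH1] /=.
- have [lt_j|ge_j] := ltnP j (size env).
    rewrite (bigD1 (Ordinal lt_j)) //= [eqn j j]eqxx scale1r big1 ?addr0 // => i.
    rewrite -val_eqE /= => ne; case: ifP => [/eqnP e|_]; last by rewrite scale0r.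
    by rewrite e eqxx in ne.
  rewrite nth_default // big1 // => i _; case: ifP => [/eqnP e|_]; last by rewrite scale0r.
  by move: (ltn_ord i); rewrite e ltnNge ge_j.
- by rewrite big1 // => i _; rewrite scale0r.
- by rewrite IH1 IH2 -big_split; apply: eq_bigr => i _; rewrite scalerDl.
- by rewrite IH1 -sumrN; apply: eq_bigr => i _; rewrite scaleNr.
- by rewrite IH1 scaler_sumr; apply: eq_bigr => i _; rewrite scalerA.
Qed.

Fixpoint lagree (k : nat) (e1 e2 : lexpr S) : Prop :=
  if k is k'.+1 then lcoef k' e1 = lcoef k' e2 /\ lagree k' e1 e2 else True.

Lemma leval_eq env e1 e2 : lagree (size env) e1 e2 -> leval env e1 = leval env e2.
Proof.
move=> h; rewrite !levalE; apply: eq_bigr => i _; congr (_ *: _).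
elim: (size env) h (nat_of_ord i) (ltn_ord i) => //= k IHk [e h] j.
by rewrite ltnS leq_eqVlt => /predU1P[->//|]; exact: IHk.
Qed.

End LinearReflection.

Ltac lmod_index x env :=
  match env with
  | ?y :: _ => let _ := match goal with _ => unify x y end in constr:(O)
  | _ :: ?env' => let i := lmod_index x env' in constr:(i.+1)
  end.

Ltac lmod_env env x :=
  lazymatch x with
  | (?y + ?z)%R => let env1 := lmod_env env y in lmod_env env1 z
  | (- ?y)%R => lmod_env env y
  | (_ *: ?y)%R => lmod_env env y
  | 0%R => env
  | _ => let r := match env with
         | _ => let i := lmod_index x env in constr:(env)
         | _ => constr:(x :: env)
         end in r
  end.

Ltac lmod_reify S env x :=
  lazymatch x with
  | (?y + ?z)%R => let e1 := lmod_reify S env y in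
                   let e2 := lmod_reify S env z in constr:(LAdd e1 e2)
  | (- ?y)%R => let e1 := lmod_reify S env y in constr:(LOpp e1)
  | (?c *: ?y)%R => let e1 := lmod_reify S env y in constr:(LScale (c : S) e1)
  | 0%R => constr:(LZero S)
  | _ => let i := lmod_index x env in constr:(LVar S i)
  end.

Ltac lmod_with S :=
  match goal with
  | |- @eq ?T ?x ?y =>
    let env0 := lmod_env (@nil T) x in
    let env := lmod_env env0 y in
    let e1 := lmod_reify S env x in
    let e2 := lmod_reify S env y in
    apply: (@leval_eq S _ env e1 e2); cbn [lagree lcoef size eqn];
    repeat match goal with |- _ /\ _ => split | |- True => exact I end
  end.

(** * The orthogonal Lie algebra inside the oscillator algebra *)

Section Index.
Variable n : nat.

(** The position of the oscillator [j]: the first and the last of the [n + 2] indices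
    carry none. *)
Definition mid (j : 'I_n) : 'I_n.+2 := lift ord0 (lift ord_max j).

Variant index_spec : 'I_n.+2 -> Type :=
| IndexFirst : index_spec ord0
| IndexMid j : index_spec (mid j)
| IndexLast : index_spec ord_max.

Lemma indexP i : index_spec i.
Proof.
case: (unliftP ord0 i) => [i1 ->|->]; last exact: IndexFirst.
case: (unliftP ord_max i1) => [j ->|->]; first exact: IndexMid.
rewrite (_ : lift ord0 ord_max = ord_max); first exact: IndexLast.
by apply: val_inj.
Qed.

Lemma mid_inj : injective mid.
Proof. by move=> j k /lift_inj /lift_inj. Qed.

Lemma rev_mid j : rev_ord (mid j) = mid (rev_ord j).
Proof. by apply: val_inj; rewrite /= /bump /=; have := ltn_ord j; lia. Qed.

Lemma rev_first : rev_ord ord0 = ord_max :> 'I_n.+2.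
Proof. by apply: val_inj; rewrite /= subn1. Qed.

Lemma rev_last : rev_ord ord_max = ord0 :> 'I_n.+2.
Proof. by apply: val_inj; rewrite /= subnn. Qed.

Lemma eq_mid j k : (mid j == mid k) = (j == k).
Proof. exact: (inj_eq mid_inj). Qed.

Lemma first_neq_mid j : (ord0 == mid j) = false.
Proof. by apply/negbTE; rewrite neq_lift. Qed.

Lemma mid_neq_first j : (mid j == ord0) = false.
Proof. by rewrite eq_sym first_neq_mid. Qed.

Lemma mid_neq_last j : (mid j == ord_max) = false.
Proof. by rewrite -val_eqE /= /bump /=; have := ltn_ord j; lia. Qed.

Lemma last_neq_mid j : (ord_max == mid j) = false.
Proof. by rewrite eq_sym mid_neq_last. Qed.

Lemma first_neq_last : (ord0 == ord_max :> 'I_n.+2) = false.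
Proof. by []. Qed.

Lemma last_neq_first : (ord_max == ord0 :> 'I_n.+2) = false.
Proof. by []. Qed.

Definition index_eqE := (eq_mid, first_neq_mid, mid_neq_first, mid_neq_last,
  last_neq_mid, first_neq_last, last_neq_first, eqxx).
Definition revE := (rev_mid, rev_first, rev_last).

End Index.

Section Oscillators.
Variables (F : numFieldType) (n : nat) (A : algType F) (a b : 'I_n -> A) (t : F).

Record ccr : Prop := Ccr {
  ccr_a : forall i j, a i * a j = a j * a i;
  ccr_b : forall i j, b i * b j = b j * b i;
  ccr_ab : forall i j, a i * b j = b j * a i + (i == j)%:R *: 1 }.

Definition number_op : A := \sum_k b k * a k.
Definition quad_b : A := \sum_k b k * b (rev_ord k).

(** The vectors [Y] and [P] of the conformal realization of [so_K] on the light
    cone: [Y] has [n + 2] commuting components with [sum_i Y_i Y_i' = 0],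
    parametrized by [n] oscillators, and [P] plays the role of the derivatives
    along [Y], with [t] as the degree of homogeneity.  Then [Y_j P_i - Y_i' P_j'],
    the usual bilinear form of an orthogonal generator, treats all positions of
    the pair [(i, j)] alike. *)
Definition coneY (i : 'I_n.+2) : A :=
  if unlift ord0 i is Some i1 then
    if unlift ord_max i1 is Some j then - b j else (- 2%:R^-1 : F) *: quad_b
  else 1.

Definition coneP (i : 'I_n.+2) : A :=
  if unlift ord0 i is Some i1 then
    if unlift ord_max i1 is Some j then - a j else 0
  else t *: 1 - number_op.

Definition so_gen (i j : 'I_n.+2) : A :=
  coneY j * coneP i - coneY (rev_ord i) * coneP (rev_ord j).

Local Notation N := number_op.
Local Notation q := quad_b.
Local Notation Y := coneY.
Local Notation P := coneP.
Local Notation d i j := ((i == j)%:R : F).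

Lemma lift_first_last : ord_max = lift ord0 ord_max :> 'I_n.+2.
Proof. by apply: val_inj. Qed.

Lemma Y_first : Y ord0 = 1. Proof. by rewrite /coneY unlift_none. Qed.
Lemma Y_mid j : Y (mid j) = - b j.
Proof. by rewrite /coneY /mid !liftK. Qed.
Lemma Y_last : Y ord_max = (- 2%:R^-1 : F) *: q.
Proof. by rewrite /coneY lift_first_last liftK unlift_none. Qed.
Lemma P_first : P ord0 = t *: 1 - N. Proof. by rewrite /coneP unlift_none. Qed.
Lemma P_mid j : P (mid j) = - a j.
Proof. by rewrite /coneP /mid !liftK. Qed.
Lemma P_last : P ord_max = 0.
Proof. by rewrite /coneP lift_first_last liftK unlift_none. Qed.

Definition coneE := (Y_first, Y_mid, Y_last, P_first, P_mid, P_last).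

Hypothesis H : ccr.

Lemma sum_delta (f : 'I_n -> A) i : \sum_k d i k *: f k = f i.
Proof.
rewrite (bigD1 i) //= eqxx scale1r big1 ?addr0 // => k.
by rewrite eq_sym => /negbTE->; rewrite scale0r.
Qed.

Lemma comm_a_N i : a i * N = N * a i + a i.
Proof.
rewrite mulr_sumr mulr_suml -[X in _ + X](sum_delta a) -big_split.
apply: eq_bigr => k _ /=; rewrite mulrA (ccr_ab H) mulrDl -mulrA (ccr_a H) mulrA.
by rewrite -scalerAl mul1r.
Qed.

Lemma comm_N_b j : N * b j = b j * N + b j.
Proof.
rewrite mulr_sumr mulr_suml -[X in _ + X](sum_delta b) -big_split.
apply: eq_bigr => k _ /=; rewrite -mulrA (ccr_ab H) mulrDr mulrA (ccr_b H) -mulrA.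
by rewrite -scalerAr mulr1 (eq_sym j).
Qed.

Lemma comm_N_q : N * q = q * N + 2%:R *: q.
Proof.
rewrite mulr_sumr mulr_suml scaler_sumr -big_split; apply: eq_bigr => k _ /=.
rewrite mulrA comm_N_b mulrDl -mulrA comm_N_b mulrDr mulrA.
by lmod_with F; ring.
Qed.

Lemma comm_b_q j : b j * q = q * b j.
Proof.
rewrite mulr_sumr mulr_suml; apply: eq_bigr => k _.
by rewrite mulrA (ccr_b H j) -mulrA (ccr_b H j) mulrA.
Qed.

Lemma comm_a_q i : a i * q = q * a i + 2%:R *: b (rev_ord i).
Proof.
rewrite scaler_nat mulr2n -{1}(sum_delta (fun k => b (rev_ord k)) i).
rewrite -(sum_delta b (rev_ord i)) mulr_sumr mulr_suml -!big_split.
apply: eq_bigr => k _ /=; rewrite mulrA (ccr_ab H) mulrDl -mulrA (ccr_ab H).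
rewrite mulrDr -scalerAl -scalerAr mul1r mulr1 mulrA.
by rewrite (inv_eq (@rev_ordK n)); lmod_with F; ring.
Qed.

Lemma comm_YY i j : Y i * Y j = Y j * Y i.
Proof.
case: (indexP i) => [|k|]; case: (indexP j) => [|l|]; rewrite !coneE ?mul1r ?mulr1 //.
- by rewrite !mulrNN (ccr_b H).
- by rewrite -scalerAl -scalerAr mulrN mulNr comm_b_q.
- by rewrite -scalerAl -scalerAr mulrN mulNr comm_b_q.
Qed.

(** The canonical commutator [d_ij], corrected because the coordinates are
    constrained to the cone and normalized by [Y_1 = 1]. *)
Lemma comm_PY i j : P i * Y j = Y j * P i + d i j *: 1 - d i ord0 *: Y j
  - d j ord_max *: Y (rev_ord i).
Proof.
case: (indexP i) => [|k|]; case: (indexP j) => [|l|];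
  rewrite ?revE ?index_eqE /= ?mulr0n ?mulr1n !coneE ?mul1r ?mulr1 ?mul0r ?mulr0 ?mulNr ?mulrN ?mulrDl ?mulrDr
    ?mulNr ?mulrN -?scalerAl -?scalerAr ?mul1r ?mulr1 ?(comm_N_b, comm_N_q, comm_a_q, ccr_ab H)
    ?scalerDr ?scalerN ?scalerA;
  by lmod_with F; field.
Qed.

Lemma comm_PP i j : P i * P j = P j * P i + d i ord0 *: P j - d j ord0 *: P i.
Proof.
case: (indexP i) => [|k|]; case: (indexP j) => [|l|];
  rewrite ?revE ?index_eqE /= ?mulr0n ?mulr1n !coneE ?mul1r ?mulr1 ?mul0r ?mulr0 ?mulNr ?mulrN ?mulrDl ?mulrDr
    ?mulNr ?mulrN -?scalerAl -?scalerAr ?mul1r ?mulr1 ?comm_a_N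
    ?scalerDr ?scalerN ?scalerA; try rewrite (ccr_a H k);
  by lmod_with F; field.
Qed.

Lemma so_gen_rev i j : so_gen (rev_ord j) (rev_ord i) = - so_gen i j.
Proof. by rewrite /so_gen !rev_ordK opprB. Qed.

Lemma rev_eq_first (i : 'I_n.+2) : (rev_ord i == ord0) = (i == ord_max).
Proof. by rewrite (inv_eq (@rev_ordK _)) rev_first. Qed.

Lemma rev_eq_last (i : 'I_n.+2) : (rev_ord i == ord_max) = (i == ord0).
Proof. by rewrite (inv_eq (@rev_ordK _)) rev_last. Qed.

(** [so_gen i j] acts on [Y] as an infinitesimal rotation, plus this multiple of [Y]
    that restores the normalization [Y_1 = 1]. *)
Definition cone_factor (i j : 'I_n.+2) : A := d j ord_max *: Y (rev_ord i) - d i ord0 *: Y j.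

Lemma comm_so_Y i j l : so_gen i j * Y l =
  Y l * so_gen i j + d i l *: Y j - d (rev_ord j) l *: Y (rev_ord i)
  + cone_factor i j * Y l.
Proof.
rewrite /so_gen /cone_factor !mulrBl !mulrBr -!mulrA !comm_PY !mulrBr !mulrDr.
rewrite !rev_ordK rev_eq_first.
rewrite -!scalerAr -!scalerAl !mulr1 !mulrA !(comm_YY l) (comm_YY (rev_ord i) j).
by lmod_with F; ring.
Qed.

Lemma comm_so_P i j k : so_gen i j * P k =
  P k * so_gen i j - d k j *: P i + d k (rev_ord i) *: P (rev_ord j)
  - cone_factor i j * P k
  + Y (rev_ord k) * (d j ord_max *: P i - d i ord0 *: P (rev_ord j)).
Proof.
rewrite /so_gen /cone_factor !mulrBl !mulrBr !mulrA !comm_PY !mulrBl !mulrDl.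
rewrite -!mulrA (comm_PP i k) (comm_PP (rev_ord j) k) rev_eq_first rev_eq_last.
rewrite !mulrBr !mulrDr -!scalerAr -!scalerAl !mul1r.
by lmod_with F; ring.
Qed.

Lemma comm_YY_factor i j l : Y l * cone_factor i j = cone_factor i j * Y l.
Proof.
by rewrite /cone_factor mulrBl mulrBr -!scalerAl -!scalerAr !(comm_YY l).
Qed.

(** [Y] is rescaled by [cone_factor] and [P] by its opposite, so that bilinear
    expressions in [Y] and [P] transform as under rotations; the remaining terms
    of [comm_so_P] are the same for the two summands of [so_gen] and cancel. *)
Lemma so_gen_comm i j k l : so_gen i j * so_gen k l = so_gen k l * so_gen i j
  + d i l *: so_gen k j - d j k *: so_gen i l
  - d i (rev_ord k) *: so_gen (rev_ord l) j + d j (rev_ord l) *: so_gen i (rev_ord k).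
Proof.
have move p m : so_gen i j * (Y p * P m) = Y p * P m * so_gen i j
    + d i p *: (Y j * P m) - d (rev_ord j) p *: (Y (rev_ord i) * P m)
    - d m j *: (Y p * P i) + d m (rev_ord i) *: (Y p * P (rev_ord j))
    + Y p * Y (rev_ord m) * (d j ord_max *: P i - d i ord0 *: P (rev_ord j)).
  rewrite mulrA comm_so_Y !mulrDl mulNr -(mulrA (Y p)) comm_so_P.
  rewrite !mulrDr !mulrN -!scalerAl -!scalerAr !mulrA comm_YY_factor.
  rewrite /cone_factor ?mulrBl ?mulNr -!scalerAl.
  by lmod_with F; ring.
rewrite {2}/so_gen mulrBr !move /so_gen !rev_ordK.
rewrite (comm_YY (rev_ord k) l) !(can_eq (@rev_ordK _)) !(inv_eq (@rev_ordK _)).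
rewrite (eq_sym k j) (eq_sym l i) -[k == _](inv_eq (@rev_ordK _)) (eq_sym _ i).
rewrite -[l == _](inv_eq (@rev_ordK _)) (eq_sym _ j).
rewrite -/(so_gen i j) !mulrBl !scalerBr.
by lmod_with F; ring.
Qed.
End Oscillators.

(** * The Lax matrix as a polynomial in the generators *)

Section Unblock.
Variable n : nat.

Lemma dim_eq : (1 + (n + 1) = n.+2)%N. Proof. by rewrite addn1. Qed.

(** The block matrices are indexed by ['I_(1 + (n + 1))], which is not convertible to
    ['I_n.+2]. *)
Definition unblock (T : Type) (B : 'M[T]_(1 + (n + 1))) : 'M[T]_n.+2 :=
  castmx (dim_eq, dim_eq) B.

Lemma conform_unblock (T : nzRingType) (B : 'M[T]_(1 + (n + 1))) :
  conform_mx 0 B = unblock B.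
Proof.
by rewrite -(conform_castmx (dim_eq, dim_eq)) conform_mx_id.
Qed.

Lemma unblockM (T : nzRingType) (B C : 'M[T]_(1 + (n + 1))) :
  unblock (B *m C) = unblock B *m unblock C.
Proof. by rewrite /unblock; case: _ / dim_eq. Qed.

Lemma cast_first : cast_ord (esym dim_eq) ord0 = lshift (n + 1) ord0.
Proof. exact: val_inj. Qed.
Lemma cast_mid j : cast_ord (esym dim_eq) (mid j) = rshift 1 (lshift 1 j).
Proof. by apply: val_inj; rewrite /= /bump /=; have := ltn_ord j; lia. Qed.
Lemma cast_last : cast_ord (esym dim_eq) ord_max = rshift 1 (rshift n ord0).
Proof. by apply: val_inj; rewrite /= addn0. Qed.

Section Entries.
Variables (R : realType) (A : algType R[i]).
Variables (M11 : 'M[{poly A}]_1) (M12 : 'rV[{poly A}]_n) (M13 : 'M[{poly A}]_1)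
  (M21 : 'cV[{poly A}]_n) (M22 : 'M[{poly A}]_n) (M23 : 'cV[{poly A}]_n)
  (M31 : 'M[{poly A}]_1) (M32 : 'rV[{poly A}]_n) (M33 : 'M[{poly A}]_1).
Let B := unblock (@block3 R A n.+2 M11 M12 M13 M21 M22 M23 M31 M32 M33).

Lemma unblock3E :
  (B ord0 ord0 = M11 0 0) * (forall j, B ord0 (mid j) = M12 0 j)
  * (B ord0 ord_max = M13 0 0)
  * (forall i, B (mid i) ord0 = M21 i 0) * (forall i j, B (mid i) (mid j) = M22 i j)
  * (forall i, B (mid i) ord_max = M23 i 0)
  * (B ord_max ord0 = M31 0 0) * (forall j, B ord_max (mid j) = M32 0 j)
  * (B ord_max ord_max = M33 0 0).
Proof.
by repeat match goal with |- _ * _ => split end; intros; rewrite /B castmxE ?cast_first ?cast_mid ?cast_last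
  !(block_mxEul, block_mxEur, block_mxEdl, block_mxEdr, row_mxEl, row_mxEr,
    col_mxEu, col_mxEd).
Qed.
End Entries.

Lemma sum_index (V : nmodType) (f : 'I_n.+2 -> V) :
  \sum_i f i = f ord0 + \sum_j f (mid j) + f ord_max.
Proof.
rewrite big_ord_recl big_ord_recr /= addrA; congr (_ + _ + _).
  by apply: eq_bigr => j _; congr f; apply: val_inj; rewrite /= /bump /=; have := ltn_ord j; lia.
by congr f; apply: val_inj.
Qed.

End Unblock.

Section LaxMatrix.
Variables (R : realType) (n : nat) (A : algType R[i]) (a b : 'I_n -> A) (t : R[i]).
Local Notation C := R[i].
Local Notation P := {poly A}.
Local Notation N := (number_op a b).
Local Notation q := (quad_b b).
Local Notation wb := (@wbar R A n.+2 b).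
Local Notation ws := (@wcol R A n.+2 a).

Definition lax_unip : 'M[P]_n.+2 := unblock (@block3 R A n.+2
  1%:M wb (opcst A (- 2%:R^-1) *: (wb *m antidiag A n.+2 *m wb^T))
  0 1%:M (- (antidiag A n.+2 *m wb^T)) 0 0 1%:M).

Definition lax_unip' : 'M[P]_n.+2 := unblock (@block3 R A n.+2
  1%:M (- wb) (opcst A (- 2%:R^-1) *: (wb *m antidiag A n.+2 *m wb^T))
  0 1%:M (antidiag A n.+2 *m wb^T) 0 0 1%:M).

Definition lax_lower : 'M[P]_n.+2 :=
  let u := lax_u A n.+2 t in let v := lax_v A n.+2 t in
  let w := ws in let J := antidiag A n.+2 in
  let mhalf := opcst A (- 2%:R^-1) in
  let k2 := opcst A (n.+2%:R / 2%:R - 2%:R) in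
  unblock (@block3 R A n.+2
         (u * (u - k2))%:M             0                 0
         (- (w *m u%:M))               (u * v)%:M        0
         (mhalf *: (w^T *m J *m w))    (w^T *m J *m v%:M) (v * (v - k2))%:M).

Lemma laxE : @lax R A n.+2 t a b = lax_unip *m lax_lower *m lax_unip'.
Proof. by rewrite /lax conform_unblock /lax_blocks !unblockM. Qed.

(** The outer factors of the Lax matrix, for [s = -1] on the left and [s = 1] on the
    right; they are constant in [x]. *)
Definition unip_mx (s : C) : 'M[A]_n.+2 := \matrix_(i, j)
  if i == ord0 then (if j == ord0 then 1 else if j == ord_max then (- 2%:R^-1 : C) *: q
                     else s *: coneY b j)
  else if i == j then 1 else if j == ord_max then - s *: coneY b (rev_ord i) else 0.

Lemma antidiag_wbar j : (antidiag A n.+2 *m wb^T) j 0 = (b (rev_ord j))%:P.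
Proof.
rewrite mxE (bigD1 (rev_ord j)) //= big1 ?addr0 ?mxE ?eqxx ?mul1r ?mxE // => k ne.
by rewrite !mxE (negbTE ne) mul0r.
Qed.

Lemma wbar_antidiag_wbar : (wb *m antidiag A n.+2 *m wb^T) 0 0 = q%:P.
Proof.
rewrite -mulmxA mxE /quad_b raddf_sum; apply: eq_bigr => j _.
by rewrite antidiag_wbar mxE /= polyCM.
Qed.

Lemma wcol_antidiag j : (ws^T *m antidiag A n.+2) 0 j = (a (rev_ord j))%:P.
Proof.
rewrite mxE (bigD1 (rev_ord j)) //= big1 ?addr0 ?mxE ?rev_ordK ?eqxx ?mulr1 // => k ne.
by rewrite !mxE eq_sym (inv_eq (@rev_ordK _)) (negbTE ne) mulr0.
Qed.

Lemma opcstM (c : C) (x : A) : opcst A c * x%:P = (c *: x)%:P.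
Proof. by rewrite /opcst -polyCM -scalerAl mul1r. Qed.

Lemma unip_mxE s : (unip_mx s ord0 ord0 = 1) * (forall j, unip_mx s ord0 (mid j) = - s *: b j)
  * (unip_mx s ord0 ord_max = (- 2%:R^-1 : C) *: q)
  * (forall i, unip_mx s (mid i) ord0 = 0) * (forall i j, unip_mx s (mid i) (mid j) = (i == j)%:R *: 1)
  * (forall i, unip_mx s (mid i) ord_max = s *: b (rev_ord i))
  * (unip_mx s ord_max ord0 = 0) * (forall j, unip_mx s ord_max (mid j) = 0)
  * (unip_mx s ord_max ord_max = 1).
Proof.
repeat match goal with |- _ * _ => split end; intros; rewrite mxE ?index_eqE ?revE ?coneE //=.
- by rewrite scalerN scaleNr.
- by case: eqP => _; rewrite ?scale1r ?scale0r.
- by rewrite scalerN scaleNr opprK.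
Qed.

Lemma lax_unipE : lax_unip = map_mx polyC (unip_mx (-1)).
Proof.
apply/matrixP => i j; rewrite mxE.
case: (indexP i) => [|k|]; case: (indexP j) => [|l|]; rewrite /lax_unip !unblock3E unip_mxE.
- by rewrite mxE.
- by rewrite mxE opprK scale1r.
- by rewrite mxE wbar_antidiag_wbar opcstM.
- by rewrite mxE.
- by rewrite mxE; case: eqP => _; rewrite ?scale1r ?scale0r.
- by rewrite mxE antidiag_wbar scaleN1r polyCN.
- by rewrite mxE.
- by rewrite mxE.
- by rewrite mxE.
Qed.

Lemma lax_unipE' : lax_unip' = map_mx polyC (unip_mx 1).
Proof.
apply/matrixP => i j; rewrite mxE.
case: (indexP i) => [|k|]; case: (indexP j) => [|l|]; rewrite /lax_unip' !unblock3E unip_mxE.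
- by rewrite mxE.
- by rewrite !mxE scaleN1r polyCN.
- by rewrite mxE wbar_antidiag_wbar opcstM.
- by rewrite mxE.
- by rewrite mxE; case: eqP => _; rewrite ?scale1r ?scale0r.
- by rewrite antidiag_wbar scale1r.
- by rewrite mxE.
- by rewrite mxE.
- by rewrite mxE.
Qed.

Local Notation al := (- 1 + t / 2%:R + n.+2%:R / 4%:R : C).
Local Notation be := (t / 2%:R + n.+2%:R / 4%:R : C).
Local Notation ga := (n.+2%:R / 2%:R - 2%:R : C).

(** The shape common to the coefficients of the middle factor of the Lax matrix. *)
Definition lower_mx (x11 x22 x33 : C) (x21 x32 : C) (x31 : A) : 'M[A]_n.+2 := \matrix_(i, j)
  if i == ord0 then (if j == ord0 then x11 *: 1 else 0)
  else if i == ord_max then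
    (if j == ord0 then x31 else if j == ord_max then x33 *: 1
     else x32 *: coneP a b t (rev_ord j))
  else if j == ord0 then x21 *: coneP a b t i
  else if i == j then x22 *: 1 else 0.

Lemma lower_mxE x11 x22 x33 x21 x32 x31 : let M := lower_mx x11 x22 x33 x21 x32 x31 in
  (M ord0 ord0 = x11 *: 1) * (forall j, M ord0 (mid j) = 0)
  * (M ord0 ord_max = 0)
  * (forall i, M (mid i) ord0 = - x21 *: a i) * (forall i j, M (mid i) (mid j) = ((i == j)%:R * x22) *: 1)
  * (forall i, M (mid i) ord_max = 0)
  * (M ord_max ord0 = x31) * (forall j, M ord_max (mid j) = - x32 *: a (rev_ord j))
  * (M ord_max ord_max = x33 *: 1).
Proof.
rewrite /=; repeat match goal with |- _ * _ => split end; intros; rewrite mxE ?index_eqE ?revE ?coneE //=.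
- by rewrite scalerN scaleNr.
- by case: eqP => _; rewrite ?mul1r ?mul0r ?scale0r.
- by rewrite scalerN scaleNr.
Qed.

Definition quad_a : A := \sum_k a (rev_ord k) * a k.

Definition lower1 := lower_mx t (-1) (- t - n%:R) 1 (-1) 0.
Definition lower0 := lower_mx (al * (al - ga)) (- (al * be)) (be * (be + ga)) al be
  ((- 2%:R^-1 : C) *: quad_a).

Lemma quadratic_coef (x y : C) k :
  (('X + opcst A x) * ('X + opcst A y))`_k =
  match k with 0 => (x * y) *: 1 | 1 => (x + y) *: 1 | 2 => 1 | _ => 0 end.
Proof.
rewrite mulrDl coefD coefXM coefCM !coefD !coefX !coefC.
case: k => [|[|[|k]]] /=; rewrite ?addr0 ?add0r ?mulr0 ?mulr1 ?coefX ?coefC /=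
  ?addr0 ?add0r //.
- by rewrite -scalerAl mul1r scalerA.
- by rewrite addrC scalerDl.
Qed.

Lemma lax_uE : lax_u A n.+2 t = 'X + opcst A al. Proof. by []. Qed.
Lemma lax_vE : lax_v A n.+2 t = 'X + opcst A (- be).
Proof. by rewrite /lax_v /opcst scaleNr polyCN. Qed.
Lemma lax_ugE : lax_u A n.+2 t - opcst A ga = 'X + opcst A (al - ga).
Proof. by rewrite lax_uE /opcst (scalerBl al ga) polyCB addrA. Qed.
Lemma lax_vgE : lax_v A n.+2 t - opcst A ga = 'X + opcst A (- (be + ga)).
Proof. by rewrite lax_vE /opcst (opprD be ga) (scalerBl (- be) ga) polyCB addrA. Qed.

Lemma linear_coef (x : A) (y : C) k : (x%:P * ('X + opcst A y))`_k =
  match k with 0 => y *: x | 1 => x | _ => 0 end.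
Proof.
rewrite coefCM coefD coefX coefC; case: k => [|[|k]] /=;
  by rewrite ?addr0 ?add0r ?mulr1 ?mulr0 -?scalerAr ?mulr1.
Qed.

Lemma lax_lower_coef i j k : (lax_lower i j)`_k =
  match k with 0 => lower0 i j | 1 => lower1 i j | 2 => (i == j)%:R | _ => 0 end.
Proof.
have scal l m (p : {poly A}) : (p%:M : 'M_n) l m = if l == m then p else 0.
  by rewrite mxE; case: eqP; rewrite ?mulr1n.
case: (indexP i) => [|l|]; case: (indexP j) => [|m|]; rewrite /lax_lower !unblock3E !lower_mxE index_eqE.
- rewrite mxE mulr1n lax_ugE lax_uE quadratic_coef; case: k => [|[|[|k]]] //.
  by congr (_ *: _); field.
- by rewrite mxE coef0; case: k => [|[|[|k]]].
- by rewrite mxE coef0; case: k => [|[|[|k]]].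
- rewrite mxE mxE big_ord1 (mxE _ _ 0 0) mulr1n mxE coefN lax_uE linear_coef.
  by case: k => [|[|[|k]]] //=; rewrite ?scaleN1r ?scaleNr ?oppr0.
- rewrite scal; case: eqP => _; last by rewrite coef0 !mul0r scale0r; case: k => [|[|[|k]]].
  rewrite lax_uE lax_vE quadratic_coef !mul1r; case: k => [|[|[|k]]] //.
    by rewrite mulrN.
  by congr (_ *: _); field.
- by rewrite mxE coef0; case: k => [|[|[|k]]].
- rewrite mxE (_ : (_ *m ws) 0 0 = quad_a%:P).
    by rewrite opcstM coefC; case: k => [|[|[|k]]].
  rewrite mxE /quad_a raddf_sum; apply: eq_bigr => m _.
  by rewrite wcol_antidiag mxE /= polyCM.
- rewrite mxE (bigD1 m) //= big1 ?addr0 => [|l /negbTE ne]; last first.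
    by rewrite scal ne mulr0.
  rewrite scal eqxx wcol_antidiag lax_vE linear_coef.
  by case: k => [|[|[|k]]] //=; rewrite opprK scale1r.
- rewrite mxE mulr1n lax_vgE lax_vE quadratic_coef; case: k => [|[|[|k]]] //.
    by rewrite mulrNN.
  by congr (_ *: _); rewrite -addn2 natrD; field.
Qed.

Lemma lax_coef i j k : (@lax R A n.+2 t a b i j)`_k =
  match k with
  | 0 => (unip_mx (-1) *m lower0 *m unip_mx 1) i j
  | 1 => (unip_mx (-1) *m lower1 *m unip_mx 1) i j
  | 2 => (unip_mx (-1) *m unip_mx 1) i j
  | _ => 0
  end.
Proof.
have -> : (@lax R A n.+2 t a b i j)`_k =
    (unip_mx (-1) *m (\matrix_(i, j) (lax_lower i j)`_k) *m unip_mx 1) i j.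
  have mulE (T : pzSemiRingType) p q r (B : 'M[T]_(p, q)) (D : 'M_(q, r)) l m :
    (B *m D) l m = \sum_k B l k * D k m by rewrite mxE.
  rewrite laxE lax_unipE lax_unipE' !mulE coef_sum; apply: eq_bigr => l _.
  rewrite (mxE _ _ l) coefMC !mulE coef_sum; congr (_ * _).
  by apply: eq_bigr => m _; rewrite (mxE _ _ i) coefCM; congr (_ * _); rewrite [RHS]mxE.
have -> : (\matrix_(i, j) (lax_lower i j)`_k) =
  match k with 0 => lower0 | 1 => lower1 | 2 => 1%:M | _ => 0 end.
  apply/matrixP => l m; rewrite mxE lax_lower_coef.
  by case: k => [|[|[|k]]]; rewrite ?mxE //; case: eqP.
by case: k => [|[|[|k]]] //; rewrite ?mulmx1 // mulmx0 mul0mx mxE.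
Qed.

Hypothesis H : ccr a b.

Lemma sum_delta_r (f : 'I_n -> A) i : \sum_k ((k == i)%:R : C) *: f k = f i.
Proof. by under eq_bigr do rewrite eq_sym; exact: sum_delta. Qed.

(** Both signs are needed: over a noncommutative ring a one-sided inverse matrix
    need not be two-sided. *)
Lemma unip_mxV s : s ^+ 2 = 1 -> unip_mx (- s) *m unip_mx s = 1%:M.
Proof.
move=> s2; have ss : s * s = 1 by rewrite -expr2.
apply/matrixP => i j; rewrite mxE sum_index.
case: (indexP i) => [|l|]; case: (indexP j) => [|m|]; rewrite !unip_mxE mxE index_eqE;
  under eq_bigr do rewrite !unip_mxE -?scalerAl -?scalerAr
    ?(mul0r, mulr0, mul1r, mulr1, scaler0) ?opprK ?scale1r ?scalerA ?ss ?(mulrC s) -?scalerA;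
  rewrite ?big1_eq ?sum_delta ?sum_delta_r ?(mul0r, mulr0, mul1r, mulr1)
    ?scale1r ?scaleNr ?addr0 ?add0r ?addNr ?subrr //.
- under eq_bigr do rewrite scale1r.
  by rewrite -/(quad_b b) mulr0n; lmod_with constr:(R[i]); field.
- by rewrite scaler_nat.
Qed.

(** Scalars of [C], unlike those of [A], can be moved across matrix products. *)
Definition scale_mx (c : C) (M : 'M[A]_n.+2) : 'M[A]_n.+2 := map_mx ( *:%R c) M.

Lemma mulmx_scale (c : C) (M N : 'M[A]_n.+2) : M *m scale_mx c N = scale_mx c (M *m N).
Proof.
apply/matrixP => i j; rewrite !mxE scaler_sumr; apply: eq_bigr => k _.
by rewrite mxE scalerAr.
Qed.

Lemma scale_mxM (c : C) (M N : 'M[A]_n.+2) : scale_mx c M *m N = scale_mx c (M *m N).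
Proof.
apply/matrixP => i j; rewrite !mxE scaler_sumr; apply: eq_bigr => k _.
by rewrite mxE scalerAl.
Qed.

Definition lax_e : C := n.+2%:R / 4%:R - 2%:R^-1.
Definition lax_d : C := - (t ^+ 2 / 4%:R) - lax_e * t - (n.+2%:R / 4%:R - 1) ^+ 2.

(** The matrix relation behind the quadratic formula for the Lax matrix.  It is
    checked on the middle factor, where the entries are simple, and then
    transported by conjugation with the unipotent factors. *)
Lemma lower0E : lower0 = scale_mx 2%:R^-1 (lower1 *m lower1) + scale_mx lax_e lower1
  + scale_mx lax_d 1%:M.
Proof.
apply/matrixP => i j.
have -> : (scale_mx 2%:R^-1 (lower1 *m lower1) + scale_mx lax_e lower1 + scale_mx lax_d 1%:M) i j =
    2%:R^-1 *: (\sum_k lower1 i k * lower1 k j) + lax_e *: lower1 i j + (lax_d * (i == j)%:R) *: 1.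
  by rewrite !mxE -scalerA scaler_nat.
rewrite sum_index /lower1 /lower0.
case: (indexP i) => [|l|]; case: (indexP j) => [|m|]; rewrite !lower_mxE index_eqE;
  under eq_bigr do rewrite !lower_mxE -?scalerAl -?scalerAr ?(mul0r, mulr0, mul1r, mulr1, scaler0) ?scaleNr ?scalerN ?scaleN1r ?opprK;
  rewrite ?big1_eq.
all: rewrite ?sum_delta ?sum_delta_r -?scalerAl -?scalerAr ?(mul0r, mulr0, mul1r, mulr1).
- by rewrite /lax_d /lax_e /=; lmod_with constr:(R[i]); field.
- by rewrite !(scaler0, scale0r, addr0).
- by rewrite !(scaler0, scale0r, addr0).
- rewrite (eq_bigr (fun i => ((l == i)%:R : C) *: a i)) => [|k _]; last first.
    by rewrite mulrN1 scaleNr opprK scale1r.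
  by rewrite sum_delta /lax_d /lax_e ?mulr0n; lmod_with constr:(R[i]); field.
- rewrite (eq_bigr (fun i => ((l == i)%:R : C) *: ((i == m)%:R *: 1))) => [|k _]; last first.
    by rewrite !mulrN1 !scaleNr scalerN opprK.
  by rewrite sum_delta /lax_d /lax_e; lmod_with constr:(R[i]); field.
- by rewrite !(scaler0, scale0r, addr0).
- rewrite (eq_bigr (fun i => - (a (rev_ord i) * a i))) => [|k _]; last by rewrite !scale1r.
  by rewrite sumrN -/quad_a ?mulr0n; lmod_with constr:(R[i]); field.
- rewrite (eq_bigr (fun i => ((i == m)%:R : C) *: - a (rev_ord i))) => [|k _]; last first.
    by rewrite scale1r mulrN1 scaleNr scalerN.
  by rewrite sum_delta_r /lax_d /lax_e ?mulr0n -addn2 natrD; lmod_with constr:(R[i]); field.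
- by rewrite /lax_d /lax_e /= -addn2 natrD; lmod_with constr:(R[i]); field.
Qed.

Lemma conj_lower1 i j : (unip_mx (-1) *m lower1 *m unip_mx 1) i j = so_gen a b t i j.
Proof.
have V0 : (lower1 *m unip_mx 1) ord0 j = t *: unip_mx 1 ord0 j.
  rewrite mxE sum_index !lower_mxE; under eq_bigr do rewrite lower_mxE mul0r.
  by rewrite big1_eq mul0r !addr0 -scalerAl mul1r.
have Vm k : (lower1 *m unip_mx 1) (mid k) j = - (a k * unip_mx 1 ord0 j) - unip_mx 1 (mid k) j.
  rewrite mxE sum_index !lower_mxE; under eq_bigr do rewrite lower_mxE -scalerAl mul1r -scalerA.
  by rewrite sum_delta mul0r addr0 !scaleN1r mulNr.
have Vl : (lower1 *m unip_mx 1) ord_max j =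
    (\sum_k a (rev_ord k) * unip_mx 1 (mid k) j) - (t + n%:R) *: unip_mx 1 ord_max j.
  rewrite mxE sum_index !lower_mxE; under eq_bigr do rewrite lower_mxE opprK scale1r.
  by rewrite mul0r add0r -scalerAl mul1r -scaleNr opprD.
set s2 := \sum_k _ in Vl.
have W0 : (unip_mx (-1) *m lower1 *m unip_mx 1) ord0 j = t *: unip_mx 1 ord0 j
    - N * unip_mx 1 ord0 j - (\sum_k b k * unip_mx 1 (mid k) j)
    - 2%:R^-1 *: (q * (s2 - (t + n%:R) *: unip_mx 1 ord_max j)).
  rewrite -mulmxA mxE sum_index V0 Vl !unip_mxE mul1r -scalerAl scaleNr.
  under eq_bigr do rewrite Vm unip_mxE opprK scale1r mulrBr mulrN mulrA.
  by rewrite big_split /= !sumrN -mulr_suml addrA.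
have Wm l : (unip_mx (-1) *m lower1 *m unip_mx 1) (mid l) j = - (a l * unip_mx 1 ord0 j)
    - unip_mx 1 (mid l) j - b (rev_ord l) * (s2 - (t + n%:R) *: unip_mx 1 ord_max j).
  rewrite -mulmxA mxE sum_index V0 Vl !unip_mxE mul0r add0r -scalerAl scaleN1r.
  under eq_bigr do rewrite Vm unip_mxE -scalerAl mul1r.
  by rewrite sum_delta.
have Wl : (unip_mx (-1) *m lower1 *m unip_mx 1) ord_max j = s2 - (t + n%:R) *: unip_mx 1 ord_max j.
  rewrite -mulmxA mxE sum_index Vl !unip_mxE mul0r add0r mul1r.
  by under eq_bigr do rewrite unip_mxE mul0r; rewrite big1_eq add0r.
have sum_ab : \sum_k a (rev_ord k) * b (rev_ord k) = N + n%:R *: 1.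
  rewrite (reindex_inj rev_ord_inj) /=.
  under eq_bigr do rewrite rev_ordK (ccr_ab H) eqxx scale1r.
  by rewrite big_split /= sumr_const card_ord scaler_nat.
case: (indexP i) => [|l|]; rewrite ?W0 ?Wm ?Wl {V0 Vm Vl W0 Wm Wl}/s2 {s2};
  case: (indexP j) => [|m|]; rewrite !unip_mxE /so_gen ?revE ?coneE;
  under eq_bigr do rewrite unip_mxE ?mulr0 -?scalerAr ?mulr1 ?scale1r;
  try under [X in q * (X - _)]eq_bigr do rewrite unip_mxE ?mulr0 -?scalerAr ?mulr1 ?scale1r.
all: rewrite ?big1_eq ?sum_delta_r ?sum_ab -?/(quad_b b).
all: rewrite ?mul1r ?mulr1 ?mul0r ?mulr0 ?mulrBr ?mulrBl ?mulrDr ?mulrN ?mulNr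
  -?scalerAl -?scalerAr ?mulrN ?mulNr ?mulr1 ?mulr0
  ?(comm_N_b H, comm_N_q H, comm_a_q H, ccr_ab H) ?scalerDr ?scalerN.
all: by lmod_with constr:(R[i]); field.
Qed.

Lemma lax_coef1 i j : (@lax R A n.+2 t a b i j)`_1 = so_gen a b t i j.
Proof. by rewrite lax_coef conj_lower1. Qed.

(** As [F] is the conjugate of [lower1] by [unip_mx 1], its matrix square is the
    conjugate of the square of [lower1], and [lower0E] gives the coefficient of [x^0]. *)
Lemma lax_horner i j (x : C) : (@lax R A n.+2 t a b i j).[x%:A] =
  2%:R^-1 *: (\sum_k so_gen a b t i k * so_gen a b t k j)
  + (x + lax_e) *: so_gen a b t i j + ((x ^+ 2 + lax_d) * (i == j)%:R) *: 1.
Proof.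
have inv1 : unip_mx (-1) *m unip_mx 1 = 1%:M by apply: unip_mxV; rewrite expr1n.
have inv2 : unip_mx 1 *m unip_mx (-1) = 1%:M by rewrite -{1}[1]opprK unip_mxV // sqrrN expr1n.
set S := \sum_k _; rewrite (@horner_coef_wide _ 3); last first.
  by apply/leq_sizeP => k; rewrite lax_coef; case: k => [|[|[|k]]].
rewrite !big_ord_recr big_ord0 /= !lax_coef inv1 add0r expr0 mulr1 expr1.
have -> : unip_mx (-1) *m lower0 *m unip_mx 1 =
    scale_mx 2%:R^-1 ((unip_mx (-1) *m lower1 *m unip_mx 1) *m (unip_mx (-1) *m lower1 *m unip_mx 1))
    + scale_mx lax_e (unip_mx (-1) *m lower1 *m unip_mx 1) + scale_mx lax_d 1%:M.
  rewrite lower0E !mulmxDr !mulmxDl !mulmx_scale !scale_mxM mulmx1 inv1.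
  congr (scale_mx _ _ + _ + _).
  by rewrite !mulmxA -(mulmxA _ (unip_mx 1)) inv2 mulmx1.
have -> : unip_mx (-1) *m lower1 *m unip_mx 1 = \matrix_(i, j) so_gen a b t i j.
  by apply/matrixP => k l; rewrite conj_lower1 mxE.
rewrite !mxE (eq_bigr (fun k => so_gen a b t i k * so_gen a b t k j)) -/S; last first.
  by move=> k _; rewrite !mxE.
have -> : (i == j)%:R = ((i == j)%:R : C) *: (1 : A) by rewrite scaler_nat.
rewrite expr2 -!scalerAr -!scalerAl ?mul1r ?mulr1 -?scalerAr ?mulr1 !scalerA.
by lmod_with constr:(R[i]); ring.
Qed.

End LaxMatrix.

(** * Cartan elements and powers of the twist parameters *)

Section Cartan.
Variables (F : numFieldType) (n : nat) (A : algType F) (a b : 'I_n -> A) (t : F).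
Local Notation S := (so_gen a b t).
Local Notation d i j := ((i == j)%:R : F).

(** The weight of the [p]-th basis vector for the [l]-th Cartan element: the opposite
    weights sit at [p] and [p']. *)
Definition weight (l p : 'I_n.+2) : F := d l p - d l (rev_ord p).

Lemma so_gen_first : S ord0 ord0 = t *: 1 - number_op a b.
Proof. by rewrite /so_gen !revE !coneE mulr0 subr0 mul1r. Qed.

Lemma so_gen_mid j : S (mid j) (mid j) = b j * a j - b (rev_ord j) * a (rev_ord j).
Proof. by rewrite /so_gen !revE !coneE !mulrNN. Qed.

Lemma so_gen_last : S ord_max ord_max = number_op a b - t *: 1.
Proof. by rewrite /so_gen !revE !coneE mulr0 mul1r sub0r opprB. Qed.

Hypothesis H : ccr a b.

Lemma comm_cartan_so l i j :
  S l l * S i j = S i j * S l l + (weight l j - weight l i) *: S i j.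
Proof.
rewrite (so_gen_comm _ H).
have dS (c c' : bool) (u v : A) : c = c' -> (c -> u = v) -> c%:R *: u = (c'%:R : F) *: v.
  by move=> <-; case: c => [/(_ isT) ->|_]; rewrite ?scale0r.
(* Each coefficient [(l == p)%:R] allows replacing [l] by [p] in its generator. *)
rewrite (dS _ _ _ (S i j) erefl); last by move=> /eqP ->.
rewrite (dS _ _ (S l j) (S i j) erefl); last by move=> /eqP ->.
rewrite (dS _ _ (S (rev_ord j) l) (- S i j) erefl); last first.
  by move=> /eqP ->; rewrite so_gen_rev.
rewrite (dS _ _ (S l (rev_ord i)) (- S i j) erefl); last first.
  by move=> /eqP ->; rewrite so_gen_rev.
by rewrite /weight; lmod_with F; ring.
Qed.

Lemma rev_swap (l p : 'I_n.+2) : (rev_ord l == p) = (l == rev_ord p).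
Proof. exact: (inv_eq (@rev_ordK _)). Qed.

Lemma cone_factor_diag l : cone_factor b l l = (- weight l ord0) *: 1.
Proof.
rewrite /cone_factor /weight rev_first; case: (indexP l) => [|j|];
  rewrite ?revE ?index_eqE ?coneE /= ?mulr0n ?mulr1n ?scale0r ?scale1r.
- by rewrite sub0r subr0 scaleN1r.
- by rewrite !subrr oppr0 scale0r.
- by rewrite subr0 sub0r opprK scale1r.
Qed.

Lemma comm_cartan_b l j :
  S l l * b j = b j * S l l + (weight l (mid j) - weight l ord0) *: b j.
Proof.
have dY (p m : 'I_n.+2) : d p m *: coneY b p = d p m *: coneY b m.
  by case: eqP => [->|_]; rewrite ?scale0r.
have := comm_so_Y t H l l (mid j).
rewrite (dY l) (dY (rev_ord l)) cone_factor_diag -scalerAl mul1r !coneE rev_swap.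
rewrite mulrN mulNr => /eqP; rewrite eqr_oppLR => /eqP ->.
by rewrite /weight; lmod_with F; ring.
Qed.

Lemma comm_cartan_a l j :
  S l l * a j = a j * S l l - (weight l (mid j) - weight l ord0) *: a j.
Proof.
have dP (p m : 'I_n.+2) : d m p *: coneP a b t p = d m p *: coneP a b t m.
  by case: eqP => [->|_]; rewrite ?scale0r.
have last0 : d l ord_max *: coneP a b t l - d l ord0 *: coneP a b t (rev_ord l) = 0.
  case: (indexP l) => [|p|]; rewrite ?revE ?index_eqE ?coneE.
  - by rewrite scale0r scaler0 subr0.
  - by rewrite !scale0r subr0.
  - by rewrite scaler0 scale0r subr0.
have := comm_so_P t H l l (mid j).
rewrite (dP l) (dP (rev_ord l)) cone_factor_diag -scalerAl mul1r last0 mulr0 addr0 !coneE.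
rewrite (eq_sym (mid j)) (eq_sym (mid j) (rev_ord l)) rev_swap.
rewrite mulrN mulNr => /eqP; rewrite eqr_oppLR => /eqP ->.
by rewrite /weight; lmod_with F; ring.
Qed.

(** The hypothesis holds for the particle-hole transformation: it maps the number
    operator [N] to [- n - N], and [t - N] to [N - t] once [t] is replaced by
    [2 - K - t], where [K = n + 2]. *)
Lemma cartan_dual (a' b' : 'I_n -> A) l :
  (forall j, b' j * a' j = - (b j * a j) - 1) ->
  so_gen a' b' (2%:R - n.+2%:R - t) (rev_ord l) (rev_ord l) = S l l.
Proof.
move=> ba'.
have N' : number_op a' b' = - number_op a b - n%:R *: 1.
  rewrite /number_op (eq_bigr _ (fun j _ => ba' j)) big_split /= !sumrN.
  by rewrite sumr_const card_ord scaler_nat.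
case: (indexP l) => [|j|]; rewrite ?revE.
- rewrite so_gen_first; rewrite /so_gen !revE !coneE mulr0 mul1r sub0r N' -addn2 natrD.
  by lmod_with F; ring.
- rewrite so_gen_mid; rewrite /so_gen !revE !coneE !mulrNN !ba' rev_ordK.
  by lmod_with F; ring.
- rewrite so_gen_last; rewrite /so_gen !revE !coneE mulr0 subr0 mul1r N' -addn2 natrD.
  by lmod_with F; ring.
Qed.
End Cartan.

Section TauPow.
Variables (R : realType) (n : nat).
Local Notation C := R[i].
Local Notation E := (fockEnd C n).
Implicit Types (H X : E) (m : 'X_{1..n}).

Lemma expCD (z w : C) : expC (z + w) = expC z * expC w.
Proof.
case: z w => [x y] [u v]; rewrite /expC /= expRD cosD sinD.
apply/eqP; rewrite eq_complex /=; apply/andP; split; apply/eqP; ring.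
Qed.

Lemma cabs_expC (z : C) : cabs (expC z) = expR (complex.Re z).
Proof.
rewrite /cabs normc_def /= !exprMn -mulrDr cos2Dsin2 mulr1 sqrtr_sqr.
by rewrite ger0_norm // expR_ge0.
Qed.

Lemma fockEnd_eqX (X Y : E) : (forall m, X 'X_[m] = Y 'X_[m]) -> X = Y.
Proof.
move=> e; apply: fockEndP => p; rewrite [p]mpolyE !linear_sum.
by apply: eq_bigr => m _; rewrite !linearZ /= e.
Qed.

Definition monomial_eigen H := forall m, exists h : C, H 'X_[m] = h *: 'X_[m].

Lemma monomial_rescaling (g : 'X_{1..n} -> C) :
  exists G : E, forall p m, (G p)@_m = g m * p@_m.
Proof.
pose f (p : {mpoly C[n]}) := \sum_(m <- msupp p) (g m * p@_m) *: 'X_[m].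
have fE p m : (f p)@_m = g m * p@_m.
  rewrite raddf_sum /=; have [mp|mp] := boolP (m \in msupp p).
    rewrite (bigD1_seq m) ?msupp_uniq //= big1 ?addr0 => [|k /negbTE ne].
      by rewrite mcoeffZ mcoeffX eqxx mulr1.
    by rewrite mcoeffZ mcoeffX ne mulr0.
  rewrite (memN_msupp_eq0 mp) mulr0 big_seq big1 // => k kp.
  rewrite mcoeffZ mcoeffX; case: eqP kp mp => [->->//|]; rewrite mulr0 //.
have f_lin : linear f.
  move=> c p q; apply/mpolyP => m.
  by rewrite mcoeffD mcoeffZ !fE mcoeffD mcoeffZ mulrDr mulrCA.
pose fL := GRing.isLinear.Build C {mpoly C[n]} {mpoly C[n]} *:%R f f_lin.
pose G : E := HB.pack f fL.
by exists G => p m; exact: fE.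
Qed.

(** [tau_pow] selects an operator with the prescribed action on eigenvectors if there
    is one.  Rescaling the monomials is such an operator, since an eigenvector of a
    diagonal operator only involves monomials with its own eigenvalue. *)
Lemma tau_powE (x : C) H s p : monomial_eigen H ->
  H p = s *: p -> tau_pow x H p = expC (s * x) *: p.
Proof.
move=> hH; rewrite /tau_pow; case: xgetP => [G _ hG|]; first exact: hG.
have [h hh] := boolp.choice hH.
have [G hG] := monomial_rescaling (fun m => expC (h m * x)).
move=> /(_ G) noG _; exfalso; apply: noG => s' p' e.
apply/mpolyP => m; rewrite hG mcoeffZ.
have hm : h m * p'@_m = s' * p'@_m.
  rewrite -[RHS]mcoeffZ -e {2}(mpolyE p') linear_sum raddf_sum /=.
  have [mp|mp] := boolP (m \in msupp p').
    rewrite (bigD1_seq m) ?msupp_uniq //= big1 ?addr0 => [|k /negbTE ne].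
      by rewrite linearZ /= hh !mcoeffZ mcoeffX eqxx mulr1 mulrC.
    by rewrite linearZ /= hh !mcoeffZ mcoeffX ne !mulr0.
  rewrite (memN_msupp_eq0 mp) mulr0 big_seq big1 // => k kp.
  rewrite linearZ /= hh !mcoeffZ mcoeffX; case: eqP kp mp => [->->//|]; rewrite !mulr0 //.
have [->|p0] := eqVneq (p'@_m) 0; first by rewrite !mulr0.
by rewrite (mulIf p0 hm).
Qed.

Lemma tau_pow_comm (x c : C) H X : monomial_eigen H ->
  H * X = X * H + c *: X ->
  tau_pow x H * X = expC (c * x) *: (X * tau_pow x H).
Proof.
move=> hH e; apply: fockEnd_eqX => m; have [h hm] := hH m.
rewrite fe_scaleE !fe_mulE (tau_powE x hH hm) linearZ /= scalerA -expCD.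
rewrite -mulrDl (@tau_powE x H (c + h) _ hH) //.
have : (H * X) 'X_[m] = (X * H + c *: X) 'X_[m] by rewrite e.
by rewrite fe_addE fe_scaleE !fe_mulE hm linearZ /= -scalerDl addrC => ->.
Qed.

Lemma prod_tau_pow_comm (r : nat) (xs c : 'I_r -> C) (Hs : 'I_r -> E) X :
  (forall l, monomial_eigen (Hs l)) ->
  (forall l, Hs l * X = X * Hs l + c l *: X) ->
  (\prod_l tau_pow (xs l) (Hs l)) * X =
  (\prod_l expC (c l * xs l)) *: (X * \prod_l tau_pow (xs l) (Hs l)).
Proof.
move=> hH e; elim/big_rec2: _ => [|l z G _ IH]; first by rewrite mul1r mulr1 scale1r.
rewrite -mulrA IH -scalerAr !mulrA (tau_pow_comm _ (hH l) (e l)) -scalerAl scalerA.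
by rewrite mulrC.
Qed.

Lemma mnm_ind (P : 'X_{1..n} -> Prop) :
  P 0%MM -> (forall j m, P m -> P (m + U_(j))%MM) -> forall m, P m.
Proof.
move=> P0 PU m; have [k] := ubnP (mdeg m); elim: k m => // k IHk m.
rewrite ltnS => mk; have [->//|] := eqVneq m 0%MM.
have [j mj|m0] := pickP (fun j => m j != 0%N); last first.
  case/eqP; apply/mnmP => j; rewrite mnm0E; apply/eqP.
  by have := m0 j; case: eqP.
move=> _; rewrite -(submK (m := U_(j)) (m' := m)) ?lep1mP //; apply/PU/IHk.
by rewrite -(submK (m := U_(j)) (m' := m)) ?lep1mP // mdegD mdeg1 addn1 in mk.
Qed.

(** A monomial is obtained from the vacuum by creation operators, each of which
    shifts the eigenvalue. *)
Lemma monomial_eigen_weyl H (c : C) (w : 'I_n -> C) :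
  H 1 = c *: 1 ->
  (forall j, H * osc_abar C j = osc_abar C j * H + w j *: osc_abar C j) ->
  monomial_eigen H.
Proof.
move=> H1 Hb; elim/mnm_ind => [|j m [h hm]]; first by exists c; rewrite mpolyX0.
exists (h + w j).
have : (H * osc_abar C j) 'X_[m] = (osc_abar C j * H + w j *: osc_abar C j) 'X_[m].
  by rewrite Hb.
rewrite fe_addE fe_scaleE !fe_mulE hm osc_abarX => ->.
by rewrite linearZ osc_abarX scalerDl.
Qed.

Lemma decaying_diagonal (G : E) (g : C) (w : 'I_n -> C) (rho : R) :
  0 < rho < 1 -> G 1 = g *: 1 ->
  (forall j, G * osc_abar C j = w j *: (osc_abar C j * G)) ->
  (forall j, cabs (w j) <= rho) -> decaying_monomial G.
Proof.
move=> r01 G1 Gb wr; exists rho, (cabs g), 0%N; split=> //; first exact: cabs_ge0.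
elim/mnm_ind => [|j m [c [m' [e hc hm]]]].
  exists g, 0%MM; rewrite mpolyX0 G1 mdeg0 expr0 mulr1; split=> //.
exists (w j * c), (m' + U_(j))%MM.
have : (G * osc_abar C j) 'X_[m] = (w j *: (osc_abar C j * G)) 'X_[m] by rewrite Gb.
rewrite fe_scaleE !fe_mulE osc_abarX e => ->; split.
- by rewrite linearZ osc_abarX scalerA.
- rewrite cabsM mdegD mdeg1 addn1 exprS mulrCA.
  by apply: ler_pM => //; exact: cabs_ge0.
- by rewrite !mdegD !mdeg1 addn0 leq_add2r -(addn0 (mdeg m)).
Qed.

End TauPow.

(** * A twisted trace is determined by the diagonal letters *)

Section TwistedTrace.
Variables (R : realType) (n : nat) (L : Type).
Local Notation C := R[i].
Local Notation E := (fockEnd C n).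
Variables (G : E) (bracket : L -> L -> seq (C * L)) (c : L -> C).
Hypothesis G_decays : decaying_monomial G.

Definition gtrace X : C := fock_trace (G * X).

Lemma trace_class_G X : weyl X -> trace_class (G * X).
Proof. by move=> wX; case: (weyl_trace_class wX (TraceMonomial G_decays)). Qed.

Lemma weyl0 : weyl (0 : E).
Proof. by rewrite -(scale0r 1); apply: WeylScale; exact: WeylOne. Qed.

Lemma gtraceD X Y : weyl X -> weyl Y -> gtrace (X + Y) = gtrace X + gtrace Y.
Proof.
by move=> wX wY; rewrite /gtrace mulrDr fock_traceD //; exact: trace_class_G.
Qed.

Lemma gtraceZ k X : weyl X -> gtrace (k *: X) = k * gtrace X.
Proof.
by move=> wX; rewrite /gtrace -scalerAr fock_traceZ //; exact: trace_class_G.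
Qed.

Lemma weyl_sum (T : Type) (s : seq T) (k : T -> C) (X : T -> E) :
  (forall x, weyl (X x)) -> weyl (\sum_(x <- s) k x *: X x).
Proof.
move=> wX; elim/big_ind: _ => [|Y Z|x _]; [exact: weyl0|exact: WeylAdd|].
exact: WeylScale.
Qed.

Lemma gtrace_sum (T : Type) (s : seq T) (k : T -> C) (X : T -> E) :
  (forall x, weyl (X x)) ->
  gtrace (\sum_(x <- s) k x *: X x) = \sum_(x <- s) k x * gtrace (X x).
Proof.
move=> wX; elim: s => [|x s IH].
  by rewrite !big_nil -(scale0r 1) gtraceZ ?mul0r //; exact: WeylOne.
rewrite !big_cons gtraceD ?gtraceZ ?IH //; first exact: WeylScale.
exact: weyl_sum.
Qed.

Definition word (Phi : L -> E) (w : seq L) : E := \prod_(p <- w) Phi p.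

Lemma word_nil Phi : word Phi [::] = 1. Proof. exact: big_nil. Qed.
Lemma word_cons Phi p w : word Phi (p :: w) = Phi p * word Phi w.
Proof. exact: big_cons. Qed.
Lemma word_cat Phi u v : word Phi (u ++ v) = word Phi u * word Phi v.
Proof. exact: big_cat. Qed.

Record quasi_commuting (Phi : L -> E) : Prop := QuasiCommuting {
  qc_weyl : forall p, weyl (Phi p);
  qc_bracket : forall p q, Phi p * Phi q = Phi q * Phi p
    + \sum_(kr <- bracket p q) kr.1 *: Phi kr.2;
  qc_twist : forall p, G * Phi p = c p *: (Phi p * G) }.

Section OneFamily.
Variable Phi : L -> E.
Hypothesis hPhi : quasi_commuting Phi.

Lemma weyl_word w : weyl (word Phi w).
Proof.
elim: w => [|p w IH]; first by rewrite word_nil; exact: WeylOne.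
rewrite word_cons; exact: (WeylMul (qc_weyl hPhi p) IH).
Qed.

Lemma gtrace_word_swap u p q v :
  gtrace (word Phi (u ++ p :: q :: v)) = gtrace (word Phi (u ++ q :: p :: v))
    + \sum_(kr <- bracket p q) kr.1 * gtrace (word Phi (u ++ kr.2 :: v)).
Proof.
rewrite -gtrace_sum => [|kr]; last exact: weyl_word.
rewrite -gtraceD; first last.
- by apply: weyl_sum => kr; exact: weyl_word.
- exact: weyl_word.
congr gtrace; rewrite !word_cat !word_cons !(mulrA (Phi _) (Phi _)) (qc_bracket hPhi p).
rewrite mulrDl mulrDr mulr_suml mulr_sumr; congr (_ + _).
by apply: eq_bigr => kr _; rewrite word_cat word_cons -scalerAl -scalerAr.
Qed.

Lemma gtrace_word_rotate p w :
  gtrace (word Phi (p :: w)) = c p * gtrace (word Phi (w ++ [:: p])).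
Proof.
rewrite word_cons word_cat word_cons word_nil mulr1 /gtrace.
rewrite mulrA (qc_twist hPhi) -scalerAl -mulrA fock_traceZ; last first.
  by case: (weyl_trace_class (qc_weyl hPhi p) (trace_class_G (weyl_word w))).
rewrite (fock_trace_cyclic (qc_weyl hPhi p)) ?mulrA //.
by apply: trace_class_G; exact: weyl_word.
Qed.

End OneFamily.

Variables Phi Phi' : L -> E.
Hypotheses (hPhi : quasi_commuting Phi) (hPhi' : quasi_commuting Phi').
Hypothesis same_or_twisted : forall p, Phi p = Phi' p \/ c p <> 1.

(** By induction on the length, with [D v] the difference of the two traces of the
    word [v]: [D] is invariant under permutations of the letters, since exchanging
    neighbours produces words of smaller length.  Rotating a letter [p] multiplies
    [D] by [c p], so [D] vanishes on every word with a letter such that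
    [c p <> 1]. *)
Lemma gtrace_word_eq w : gtrace (word Phi w) = gtrace (word Phi' w).
Proof.
have [N] := ubnP (size w); elim: N w => // N IHN w; rewrite ltnS => szw.
pose D v := gtrace (word Phi v) - gtrace (word Phi' v).
suff : D w = 0 by move=> /eqP; rewrite subr_eq0 => /eqP.
have Dswap u p q v : (size (u ++ p :: q :: v) <= N)%N ->
    D (u ++ p :: q :: v) = D (u ++ q :: p :: v).
  move=> szv.
  rewrite /D (gtrace_word_swap hPhi u p) (gtrace_word_swap hPhi' u p) opprD addrACA -sumrB.
  rewrite [X in _ + X]big1 ?addr0 // => kr _; rewrite -mulrBr IHN ?subrr ?mulr0 //.
  by apply: leq_trans szv; rewrite !size_cat /= !addnS !ltnS.
have Dmove u p v : (size (u ++ p :: v) <= N)%N -> D (u ++ p :: v) = D (u ++ v ++ [:: p]).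
  elim: v u => [//|q v IHv] u szv; rewrite Dswap // -cat_rcons IHv ?cat_rcons //.
  by move: szv; rewrite !size_cat /=.
have Dtwisted u p v : (size (u ++ p :: v) <= N)%N -> c p <> 1 -> D (u ++ p :: v) = 0.
  move=> szv cp; rewrite Dmove //; set x := u ++ v.
  have e1 : D (p :: x) = D (x ++ [:: p]).
    by rewrite -(Dmove [::]) //; move: szv; rewrite /x /= !size_cat /= addnS.
  have e2 : D (p :: x) = c p * D (x ++ [:: p]).
    by rewrite /D (gtrace_word_rotate hPhi) (gtrace_word_rotate hPhi') mulrBr.
  rewrite catA -/x; apply/eqP; move/eqP: e1; rewrite e2 -subr_eq0 -{2}[D _]mul1r -mulrBl.
  by rewrite mulf_eq0 subr_eq0 => /orP[/eqP|].
have [[u [p [v [ew cp]]]]|alleq] :=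
    pselect (exists u p v, w = u ++ p :: v /\ c p <> 1); first by rewrite ew Dtwisted -?ew.
suff e : word Phi w = word Phi' w by rewrite /D e subrr.
elim: w {szw} alleq => [|p w IHw] h; first by rewrite !word_nil.
rewrite !word_cons IHw => [|[u [q [v [ew cq]]]]]; last first.
  by apply: h; exists (p :: u), q, v; rewrite ew.
by case: (same_or_twisted p) => [->//|cp]; case: h; exists [::], p, w.
Qed.

(** Pairs of values of one noncommutative polynomial at the families [Phi] and
    [Phi']. *)
Definition joint (X X' : E) : Prop := exists s : seq (C * seq L),
  X = \sum_(kw <- s) kw.1 *: word Phi kw.2 /\
  X' = \sum_(kw <- s) kw.1 *: word Phi' kw.2.

Lemma joint_gtrace X X' : joint X X' -> gtrace X = gtrace X'.
Proof.
move=> [s [-> ->]]; rewrite !gtrace_sum; first last.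
- by move=> kw; exact: (weyl_word hPhi).
- by move=> kw; exact: (weyl_word hPhi').
by apply: eq_bigr => kw _; rewrite gtrace_word_eq.
Qed.

Lemma joint_one : joint 1 1.
Proof. by exists [:: (1, [::])]; rewrite !big_seq1 !scale1r !word_nil. Qed.

Lemma joint_letter p : joint (Phi p) (Phi' p).
Proof.
by exists [:: (1, [:: p])]; rewrite !big_seq1 !scale1r !word_cons !word_nil !mulr1.
Qed.

Lemma joint_zero : joint 0 0.
Proof. by exists [::]; rewrite !big_nil. Qed.

Lemma joint_add X X' Y Y' : joint X X' -> joint Y Y' -> joint (X + Y) (X' + Y').
Proof.
by move=> [s [-> ->]] [u [-> ->]]; exists (s ++ u); rewrite !big_cat.
Qed.

Lemma joint_scale k X X' : joint X X' -> joint (k *: X) (k *: X').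
Proof.
move=> [s [-> ->]]; exists [seq (k * kw.1, kw.2) | kw <- s]; rewrite !big_map /=.
by split; rewrite scaler_sumr; apply: eq_bigr => kw _; rewrite scalerA.
Qed.

Lemma joint_mul X X' Y Y' : joint X X' -> joint Y Y' -> joint (X * Y) (X' * Y').
Proof.
move=> [s [-> ->]] [u [-> ->]].
exists [seq (x.1 * y.1, x.2 ++ y.2) | x <- s, y <- u].
by split; rewrite big_allpairs_dep mulr_suml; apply: eq_bigr => x _;
  rewrite mulr_sumr; apply: eq_bigr => y _;
  rewrite /= word_cat -scalerAl -scalerAr scalerA.
Qed.

Lemma joint_sum (T : Type) (s : seq T) (X X' : T -> E) :
  (forall x, joint (X x) (X' x)) -> joint (\sum_(x <- s) X x) (\sum_(x <- s) X' x).
Proof.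
move=> h; elim/big_rec2: _ => [|x Y Y' _]; [exact: joint_zero|exact: joint_add].
Qed.

Lemma joint_prod (T : Type) (s : seq T) (X X' : T -> E) :
  (forall x, joint (X x) (X' x)) -> joint (\prod_(x <- s) X x) (\prod_(x <- s) X' x).
Proof.
move=> h; elim/big_rec2: _ => [|x Y Y' _]; [exact: joint_one|exact: joint_mul].
Qed.

End TwistedTrace.

(** * Permutation of the indices and of the oscillators *)

Section SwapIndex.
Variable n : nat.
Local Notation I := 'I_n.+2.

(** The involution of the indices given by the matrix [Bhat k] for [k <= r]; the matrix
    [Bhat k'] gives this involution followed by [i |-> i']. *)
Definition swap_index (k i : I) : I :=
  if i == ord0 then k else if i == k then ord0
  else if i == ord_max then rev_ord k else if i == rev_ord k then ord_max else i.

Variables (k : I).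
Hypothesis hk : (k < n.+2./2)%N.

Lemma first_half : (k + k < n.+1)%N.
Proof. by move: hk; rewrite -{2}(odd_double_half n.+2) => ?; have := odd_double_half n.+2; lia. Qed.

Lemma swap_indexK : involutive (swap_index k).
Proof.
move=> i; apply: val_inj; have h := first_half; have ik := ltn_ord k; have ii := ltn_ord i.
by rewrite /swap_index -!val_eqE /=; repeat (case: ifP => /=); lia.
Qed.

Lemma swap_index_rev i : swap_index k (rev_ord i) = rev_ord (swap_index k i).
Proof.
apply: val_inj; have h := first_half; have ik := ltn_ord k; have ii := ltn_ord i.
by rewrite /swap_index -!val_eqE /=; repeat (case: ifP => /=); lia.
Qed.

Lemma swap_index_first : swap_index k ord0 = k.
Proof. by rewrite /swap_index eqxx. Qed.

(** The oscillators that are flipped are those whose index is sent to the left of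
    [k], as the next lemma shows for the others, and this makes every creation operator
    decrease the modulus of the eigenvalue of [G]. *)
Lemma swap_mid_low (j : 'I_n) : (j < k)%N -> (swap_index k (mid j) < k)%N.
Proof.
move=> jk; have h := first_half; have ik := ltn_ord k; have ij := ltn_ord j.
by rewrite /swap_index -!val_eqE /= /bump /=; repeat (case: ifP => /=); rewrite /bump; lia.
Qed.

Lemma swap_mid_high (j : 'I_n) : (k <= j)%N -> (k < swap_index k (mid j))%N.
Proof.
move=> jk; have h := first_half; have ik := ltn_ord k; have ij := ltn_ord j.
by rewrite /swap_index -!val_eqE /= /bump /=; repeat (case: ifP => /=); rewrite /bump; lia.
Qed.

Variable R : realType.
Local Notation C := R[i].

Lemma sum_delta_mx (P : pred I) (f : I -> I) i j :
  (\sum_(l | P l) delta_mx l (f l) : 'M[C]_n.+2) i j = (P i && (j == f i))%:R.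
Proof.
rewrite summxE; case Pi: (P i) => /=.
  rewrite (bigD1 i) //= mxE eqxx big1 ?addr0 // => l /andP[_ ne].
  by rewrite mxE eq_sym (negbTE ne).
rewrite big1 // => l Pl; rewrite mxE; case: eqP => // e.
by rewrite -e Pi in Pl.
Qed.

Lemma idx_firstE : idx_first k = ord0. Proof. exact: val_inj. Qed.
Lemma idx_first_revE : idx_first (rev_ord k) = ord0. Proof. exact: val_inj. Qed.

Lemma Bhat_low : Bhat R k = \matrix_(i, j) (j == swap_index k i)%:R.
Proof.
apply/matrixP => i j; rewrite /Bhat idx_firstE rev_first hk.
have h := first_half; have ik := ltn_ord k; have ii := ltn_ord i; have ij := ltn_ord j.
case: (eqVneq k ord0) => [k0|k0].
  rewrite !mxE eq_sym; congr (_ == _)%:R.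
  by apply: val_inj; move: ii; rewrite k0 /swap_index -!val_eqE /=; repeat (case: ifP => /=); lia.
rewrite ifF; last by move: k0; rewrite -!val_eqE /=; lia.
rewrite mxE sum_delta_mx !mxE -!natrD; congr _%:R.
by move: k0; rewrite /swap_index -!val_eqE /=; repeat (case: ifP => /=); lia.
Qed.

Lemma Bhat_high : Bhat R (rev_ord k) = \matrix_(i, j) (j == rev_ord (swap_index k i))%:R.
Proof.
apply/matrixP => i j; rewrite /Bhat idx_first_revE rev_first rev_ordK.
have h := first_half; have ik := ltn_ord k; have ii := ltn_ord i; have ij := ltn_ord j.
rewrite ifF; last by rewrite -!val_eqE /=; lia.
rewrite rev_eq_last; case: (eqVneq k ord0) => [k0|k0].
  rewrite (sum_delta_mx predT) mxE /=; congr (_ == _)%:R.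
  by apply: val_inj; move: ii; rewrite k0 /swap_index -!val_eqE /=; repeat (case: ifP => /=); lia.
rewrite ifF; last by have := odd_double_half n.+2; move: hk => /=; lia.
rewrite mxE sum_delta_mx !mxE -!natrD; congr _%:R.
by move: k0; rewrite /swap_index -!val_eqE /=; repeat (case: ifP => /=); lia.
Qed.

Lemma perm_inv (s : I -> I) (B : 'M[C]_n.+2) : involutive s ->
  B = \matrix_(i, j) (j == s i)%:R -> invmx B = B.
Proof.
move=> sK BE; have BB : B *m B = 1%:M.
  apply/matrixP => i j; rewrite mxE (bigD1 (s i)) //= big1 ?addr0 => [|l ne].
    by rewrite BE !mxE eqxx mul1r sK eq_sym.
  by rewrite BE !mxE (negbTE ne) mul0r.
have Bu : B \in unitmx by case/mulmx1_unit: BB.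
by rewrite -[LHS]mulmx1 -BB mulmxA mulVmx // mul1mx.
Qed.

Lemma conj_perm (A : algType C) (s : I -> I) (B : 'M[C]_n.+2) (L : 'M[{poly A}]_n.+2) i j :
  involutive s -> B = \matrix_(i, j) (j == s i)%:R ->
  (map_mx (opcst A) B *m L *m map_mx (opcst A) (invmx B)) i j = L (s i) (s j).
Proof.
move=> sK BE; rewrite (perm_inv sK BE).
have op (b : bool) : opcst A b%:R = b%:R.
  by case: b; rewrite /opcst ?scale1r ?scale0r.
have BmE l m : map_mx (opcst A) B l m = (m == s l)%:R by rewrite mxE BE mxE op.
rewrite mxE (bigD1 (s j)) //= [X in _ + X]big1 ?addr0 => [|l ne]; last first.
  rewrite BmE (_ : j == s l = false) ?mulr0 //.
  by apply: contraNF ne => /eqP ->; rewrite sK.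
rewrite BmE sK eqxx mulr1 mxE (bigD1 (s i)) //= big1 ?addr0 => [|l ne].
  by rewrite BmE eqxx mul1r.
by rewrite BmE (negbTE ne) mul0r.
Qed.

End SwapIndex.

Section TwistedOscillators.
Variables (R : realType) (n : nat) (k : 'I_n.+2).
Local Notation C := R[i].
Local Notation E := (fockEnd C n).
Hypothesis hk : (k < n.+2./2)%N.
Local Notation a := (@tw_a R n.+2 k).
Local Notation b := (@tw_abar R n.+2 k).
Local Notation a' := (@tw_a R n.+2 (rev_ord k)).
Local Notation b' := (@tw_abar R n.+2 (rev_ord k)).

Lemma flipped_low j : flipped k j = (j < k)%N.
Proof. by rewrite /flipped hk. Qed.

Lemma flipped_high j : flipped (rev_ord k) j = ~~ (j < k)%N.
Proof.
have h := first_half hk; have ij := ltn_ord j.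
rewrite /flipped ifF; last by have := odd_double_half n.+2; move: hk => /=; lia.
by rewrite rev_ordK; lia.
Qed.

Lemma osc_commE (i j : 'I_n) :
  osc_a C i * osc_abar C j = osc_abar C j * osc_a C i + (i == j)%:R *: 1.
Proof.
have := osc_comm C i j => /eqP; rewrite subr_eq => /eqP ->.
by rewrite addrC scaler_nat.
Qed.

Lemma ccr_flip (f : pred 'I_n) :
  ccr (fun j => if f j then osc_abar C j else osc_a C j)
      (fun j => if f j then - osc_a C j else osc_abar C j).
Proof.
have ab0 (i j : 'I_n) : i != j -> osc_a C i * osc_abar C j = osc_abar C j * osc_a C i.
  by move=> /negbTE ne; rewrite osc_commE ne scale0r addr0.
split=> i j; have [<-|ne] := eqVneq i j => //.
- case: (f i); case: (f j).
  + exact: osc_abarA.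
  + by rewrite ab0 // eq_sym.
  + exact: ab0.
  + exact: osc_aA.
- case: (f i); case: (f j).
  + by rewrite mulrNN [RHS]mulrNN; exact: osc_aA.
  + by rewrite mulNr mulrN ab0.
  + by rewrite mulNr mulrN ab0 // eq_sym.
  + exact: osc_abarA.
- case: (f i); last by rewrite osc_commE eqxx.
  by rewrite mulrN mulNr osc_commE eqxx opprD addrNK.
- rewrite scale0r addr0; case: (f i); case: (f j).
  + by rewrite mulrN mulNr ab0 // eq_sym.
  + exact: osc_abarA.
  + by rewrite mulrN mulNr; congr (- _); exact: osc_aA.
  + exact: ab0.
Qed.

End TwistedOscillators.

(** * One term of the transfer matrix *)

Section Family.
Variables (R : realType) (n : nat).
Local Notation C := R[i].
Local Notation I := 'I_n.+2.
Local Notation E := (fockEnd C n).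
Variables (a b : 'I_n -> E) (t : C) (s : I -> I).
Hypotheses (H : ccr a b) (sK : involutive s)
  (s_rev : forall i, s (rev_ord i) = rev_ord (s i)).
Hypotheses (wa : forall j, weyl (a j)) (wb : forall j, weyl (b j)).
Local Notation d i j := ((i == j)%:R : C).

(** The letters of the general argument: [so_gen] with its indices permuted by an
    involution [s] commuting with [i |-> i'].  Such a permutation preserves the
    commutation relations of [so_K]. *)
Definition so_family (ij : I * I) : E := so_gen a b t (s ij.1) (s ij.2).
Local Notation Phi := so_family.

Definition so_bracket (p q : I * I) : seq (C * (I * I)) :=
  [:: (d p.1 q.2, (q.1, p.2)); (- d p.2 q.1, (p.1, q.2));
      (- d p.1 (rev_ord q.1), (rev_ord q.2, p.2));
      (d p.2 (rev_ord q.2), (p.1, rev_ord q.1))].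

Lemma so_family_bracket p q : Phi p * Phi q = Phi q * Phi p
  + \sum_(kr <- so_bracket p q) kr.1 *: Phi kr.2.
Proof.
case: p q => [i j] [k l]; rewrite /so_bracket !big_cons big_nil /Phi /= !s_rev.
rewrite (so_gen_comm _ H) !(inj_eq (inv_inj sK)).
rewrite -!s_rev !(inj_eq (inv_inj sK)) !s_rev.
by lmod_with constr:(R[i]); ring.
Qed.

Lemma weyl_opp X : weyl X -> weyl (- X : E).
Proof. by rewrite -scaleN1r; exact: WeylScale. Qed.

Lemma weyl_bigsum (T : Type) (r : seq T) (X : T -> E) :
  (forall x, weyl (X x)) -> weyl (\sum_(x <- r) X x).
Proof.
by move=> wX; elim/big_ind: _ => [|Y Z|x _]; [exact: weyl0|exact: WeylAdd|].
Qed.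

Lemma weyl_coneY i : weyl (coneY b i).
Proof.
case: (indexP i) => [|j|]; rewrite !coneE; [exact: WeylOne|exact: weyl_opp|].
by apply: WeylScale; apply: weyl_bigsum => j; exact: WeylMul.
Qed.

Lemma weyl_coneP i : weyl (coneP a b t i).
Proof.
case: (indexP i) => [|j|]; rewrite !coneE; [|exact: weyl_opp|exact: weyl0].
apply: WeylAdd; first by apply: WeylScale; exact: WeylOne.
by apply: weyl_opp; apply: weyl_bigsum => j; exact: WeylMul.
Qed.

Lemma weyl_so_family p : weyl (Phi p).
Proof.
rewrite /Phi /so_gen; apply: WeylAdd; last apply: weyl_opp.
  by apply: WeylMul; [exact: weyl_coneY|exact: weyl_coneP].
by apply: WeylMul; [exact: weyl_coneY|exact: weyl_coneP].
Qed.

Lemma weight_family l p : weight C (s l) (s p) = weight C l p.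
Proof. by rewrite /weight -s_rev !(inj_eq (inv_inj sK)). Qed.

Lemma cartan_family l p : Phi (l, l) * Phi p =
  Phi p * Phi (l, l) + (weight C l p.2 - weight C l p.1) *: Phi p.
Proof. by rewrite /Phi /= (comm_cartan_so _ H) !weight_family. Qed.

Lemma horner_family i j (x : C) : (@lax R E n.+2 t a b (s i) (s j)).[x%:A] =
  2%:R^-1 *: (\sum_k Phi (i, k) * Phi (k, j))
  + (x + lax_e R n) *: Phi (i, j) + ((x ^+ 2 + lax_d n t) * d i j) *: 1.
Proof.
rewrite (lax_horner _ H) (inj_eq (inv_inj sK)) (reindex_inj (inv_inj sK)).
by congr (_ *: _ + _ + _).
Qed.

Variables (r : nat) (xs : 'I_r -> C) (ix : 'I_r -> I).

Definition gibbs : E := \prod_(l < r) tau_pow (xs l) (Phi (ix l, ix l)).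

Definition twist (p : I * I) : C :=
  \prod_(l < r) expC ((weight C (ix l) p.2 - weight C (ix l) p.1) * xs l).

Lemma family_quasi_commuting :
  (forall l, monomial_eigen (Phi (ix l, ix l))) ->
  quasi_commuting gibbs so_bracket twist Phi.
Proof.
move=> hH; split=> [p|p q|p]; first exact: weyl_so_family.
  exact: so_family_bracket.
by rewrite /gibbs /twist; apply: prod_tau_pow_comm => // l; exact: cartan_family.
Qed.

End Family.

(** * Weights and the convergence condition *)

Section Weights.
Variables (R : realType) (n : nat) (y : 'I_(n.+2./2) -> R).
Local Notation C := R[i].
Local Notation I := 'I_n.+2.
Local Notation r := (n.+2./2).
Local Notation ix := (@idx n.+2).

(** If [y l] is the logarithm of [|tau_l|], this is the logarithm of [|tau_p|], where
    [tau_p' = 1 / tau_p], and [tau_p = 1] for the middle index of an odd [K].  The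
    convergence condition says that it decreases strictly over all [K] indices. *)
Definition level (p : I) : R := \sum_(l < r) weight R (ix l) p * y l.

Lemma weight_rev (l p : I) : weight R l (rev_ord p) = - weight R l p.
Proof. by rewrite /weight rev_ordK opprB. Qed.

Lemma level_rev p : level (rev_ord p) = - level p.
Proof. by rewrite /level -sumrN; apply: eq_bigr => l _; rewrite weight_rev mulNr. Qed.

Lemma half_idx (l : 'I_r) : (l + l < n.+1)%N.
Proof. exact: (@first_half n (ix l) (ltn_ord l)). Qed.

Lemma level_idx l : level (ix l) = y l.
Proof.
have hl := half_idx l.
rewrite /level (bigD1 l) //= big1 ?addr0 => [|m ne].
  rewrite /weight eqxx (_ : ix l == rev_ord (ix l) = false) ?subr0 ?mul1r //.
  by move: hl; rewrite -val_eqE /=; lia.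
have hm := half_idx m.
have e1 : (ix m == ix l) = false by move: ne => /negbTE; rewrite -!val_eqE.
have e2 : (ix m == rev_ord (ix l)) = false.
  by move: hl hm; rewrite -val_eqE /=; lia.
by rewrite /weight e1 e2 subrr mul0r.
Qed.

Lemma idx_or_rev (p : I) :
  [\/ exists l, p = ix l, exists l, p = rev_ord (ix l) | p = rev_ord p].
Proof.
have hr := odd_double_half n.+2; have hp := ltn_ord p.
have [pr|pr] := ltnP p r; first by constructor 1; exists (Ordinal pr); exact: val_inj.
have [qr|qr] := ltnP (rev_ord p) r.
  by constructor 2; exists (Ordinal qr); rewrite -[LHS]rev_ordK; congr rev_ord; exact: val_inj.
by constructor 3; apply: val_inj; move: qr => /=; lia.
Qed.

Hypothesis y_decr : forall l m : 'I_r, (l < m)%N -> y m < y l.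
Hypothesis y_gt0 : forall l, 0 < y l.

Lemma level_mid (p : I) : p = rev_ord p -> level p = 0.
Proof. by move=> e; have := level_rev p; rewrite -e; lra. Qed.

Lemma level_decr (i j : I) : (i < j)%N -> level j < level i.
Proof.
have hr := odd_double_half n.+2; have hi := ltn_ord i; have hj := ltn_ord j.
case: (idx_or_rev i) => [[l ->]|[l ->]|ei]; case: (idx_or_rev j) => [[m ->]|[m ->]|ej] ij;
  rewrite ?level_rev ?level_idx ?(level_mid ei) ?(level_mid ej).
- exact: y_decr.
- by have := y_gt0 l; have := y_gt0 m; lra.
- exact: y_gt0.
- by have hl := half_idx l; have hm := half_idx m; move: ij hl hm => /=; lia.
- rewrite ltrN2; apply: y_decr.
  by have hl := half_idx l; have hm := half_idx m; move: ij hl hm => /=; lia.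
- have hl := half_idx l; have := congr1 val ej; move: ij hl => /=; lia.
- have hm := half_idx m; have := congr1 val ei; move: ij hm => /=; lia.
- by rewrite oppr_lt0; exact: y_gt0.
- have := congr1 val ei; have := congr1 val ej; move: ij => /=; lia.
Qed.

Lemma level_inj (i j : I) : i != j -> level i != level j.
Proof.
rewrite -val_eqE neq_ltn => /orP[] /level_decr; first by move/lt_eqF; rewrite eq_sym => ->.
by move/lt_eqF ->.
Qed.

End Weights.

Section ComplexTwist.
Variable R : realType.
Local Notation C := R[i].

Lemma cabs_prod_expC (r : nat) (xs : 'I_r -> C) (c : 'I_r -> R) :
  cabs (\prod_(l < r) expC ((c l)%:C%C * xs l)) =
  expR (\sum_(l < r) c l * complex.Re (xs l)).
Proof.
elim/big_rec2: _ => [|l z w _ IH]; first by rewrite expR0 (cabs_nat R 1).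
rewrite cabsM IH cabs_expC expRD; congr (expR _ * _).
by case: (xs l) => u v /=; rewrite mul0r subr0.
Qed.

Lemma weight_complex n (l p : 'I_n.+2) : weight C l p = (weight R l p)%:C%C.
Proof. by rewrite /weight rmorphB !rmorph_nat. Qed.

End ComplexTwist.

(** * Duality between the terms for k and k' *)

Section Duality.
Variables (R : realType) (n N : nat) (xs : 'I_(n.+2./2) -> R[i]).
Local Notation C := R[i].
Local Notation r := (n.+2./2).
Local Notation I := 'I_n.+2.
Local Notation E := (fockEnd C n).
Local Notation ix := (@idx n.+2).
Let y l := complex.Re (xs l).
Hypothesis y_decr : forall l m : 'I_r, (l < m)%N -> y m < y l.
Hypothesis y_gt0 : forall l, 0 < y l.
Variables (k0 : 'I_r) (t : C).
Let k : I := ix k0.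
Let hk : (k < r)%N. Proof. exact: (ltn_ord k0). Qed.
Local Notation s := (swap_index k).
Local Notation s' := (fun i => rev_ord (swap_index k i)).
Local Notation a := (@tw_a R n.+2 k).
Local Notation b := (@tw_abar R n.+2 k).
Local Notation a' := (@tw_a R n.+2 (rev_ord k)).
Local Notation b' := (@tw_abar R n.+2 (rev_ord k)).
Local Notation t' := (2%:R - n.+2%:R - t).
Local Notation Phi := (so_family a b t s).
Local Notation Phi' := (so_family a' b' t' s').

Lemma dual_swapK : involutive s'.
Proof. by move=> i; rewrite /= (swap_index_rev hk) rev_ordK (swap_indexK hk). Qed.

Lemma dual_swap_rev i : s' (rev_ord i) = rev_ord (s' i).
Proof. by rewrite /= (swap_index_rev hk). Qed.

Lemma ccr_low : ccr a b. Proof. exact: (@ccr_flip R n (flipped k)). Qed.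
Lemma ccr_high : ccr a' b'. Proof. exact: (@ccr_flip R n (flipped (rev_ord k))). Qed.

Lemma weyl_tw (q : I) (j : 'I_n) : weyl (tw_a R q j) /\ weyl (tw_abar R q j).
Proof.
rewrite /tw_a /tw_abar; case: (flipped q j); split; try exact: WeylA; try exact: WeylAbar.
by apply: weyl_opp; exact: WeylA.
Qed.

Lemma lax_low_entry (u : C) i j : lax_k u k i j = lax u a b (s i) (s j).
Proof. by rewrite /lax_k (conj_perm _ _ _ (swap_indexK hk) (Bhat_low hk R)). Qed.

Lemma lax_high_entry (u : C) i j :
  lax_k u (rev_ord k) i j = lax u a' b' (s' i) (s' j).
Proof. by rewrite /lax_k (conj_perm _ _ _ dual_swapK (Bhat_high hk R)). Qed.

(** The oscillator [j] is flipped for exactly one of [k] and [k']. *)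
Lemma dual_number j : b' j * a' j = - (b j * a j) - 1.
Proof.
rewrite /tw_a /tw_abar (flipped_low hk) (flipped_high hk); case: (j < k)%N => /=.
  by rewrite mulNr opprK osc_commE eqxx scale1r addrK.
by rewrite mulNr osc_commE eqxx scale1r opprD.
Qed.

(** This is where the value [2 - K - t] comes from. *)
Lemma cartan_same l : Phi' (l, l) = Phi (l, l).
Proof. by rewrite /so_family /= (cartan_dual t (s l) dual_number). Qed.

(** For a flipped oscillator, [osc_abar j] is the image of [a_j] instead of
    [abar_j], hence the sign. *)
Definition osc_weight (p : I) (j : 'I_n) : R :=
  (if (j < k)%N then -1 else 1) * (weight R p (s (mid j)) - weight R p k).

Lemma cartan_osc p j : Phi (p, p) * osc_abar C j =
  osc_abar C j * Phi (p, p) + (osc_weight p j)%:C%C *: osc_abar C j.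
Proof.
have hw : weight R (s p) (mid j) - weight R (s p) ord0 =
    weight R p (s (mid j)) - weight R p k.
  have e q : weight R (s p) (s q) = weight R p q.
    by rewrite /weight -(swap_index_rev hk) !(inj_eq (inv_inj (swap_indexK hk))).
  have sk : s k = ord0 by rewrite -{2}(swap_index_first k) (swap_indexK hk).
  by rewrite -(e (s (mid j))) -(e k) (swap_indexK hk) sk.
rewrite /so_family /osc_weight /= -hw.
have [jk|kj] := ltnP j k.
  have ea : a j = osc_abar C j by rewrite /tw_a (flipped_low hk) jk.
  rewrite -ea (comm_cartan_a t ccr_low) !weight_complex -rmorphB -scaleNr mulN1r.
  by rewrite rmorphN.
have eb : b j = osc_abar C j by rewrite /tw_abar (flipped_low hk) ltnNge kj.
by rewrite -eb (comm_cartan_b t ccr_low) !weight_complex -rmorphB mul1r.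
Qed.

Definition vacuum_eigen (X : E) : Prop := exists c : C, X 1 = c *: (1 : {mpoly C[n]}).

Lemma vacuum_eigen_add X Y : vacuum_eigen X -> vacuum_eigen Y -> vacuum_eigen (X + Y).
Proof.
by move=> [c hc] [d hd]; exists (c + d); rewrite fe_addE hc hd scalerDl.
Qed.

Lemma vacuum_eigen_scale c X : vacuum_eigen X -> vacuum_eigen (c *: X).
Proof. by move=> [d hd]; exists (c * d); rewrite fe_scaleE hd scalerA. Qed.

Lemma vacuum_eigen_opp X : vacuum_eigen X -> vacuum_eigen (- X).
Proof. by rewrite -scaleN1r; exact: vacuum_eigen_scale. Qed.

Lemma vacuum_eigen_one : vacuum_eigen 1.
Proof. by exists 1; rewrite scale1r. Qed.

Lemma vacuum_eigen_ba j : vacuum_eigen (b j * a j).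
Proof.
rewrite /tw_a /tw_abar; case: (flipped k j).
  rewrite mulNr osc_commE eqxx scale1r; apply: vacuum_eigen_opp.
  apply: vacuum_eigen_add; last exact: vacuum_eigen_one.
  by exists 0; rewrite fe_mulE osc_a_vacuum linear0 scale0r.
by exists 0; rewrite fe_mulE osc_a_vacuum linear0 scale0r.
Qed.

Lemma vacuum_eigen_cartan p : vacuum_eigen (Phi (p, p)).
Proof.
have vN : vacuum_eigen (number_op a b).
  rewrite /number_op; elim/big_ind: _ => [|X Y|j _].
  - by exists 0; rewrite scale0r.
  - exact: vacuum_eigen_add.
  - exact: vacuum_eigen_ba.
rewrite /so_family /=; case: (indexP (s p)) => [|j|].
- rewrite so_gen_first; apply: vacuum_eigen_add; last exact: vacuum_eigen_opp.
  by apply: vacuum_eigen_scale; exact: vacuum_eigen_one.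
- rewrite so_gen_mid; apply: vacuum_eigen_add; last apply: vacuum_eigen_opp.
    exact: vacuum_eigen_ba.
  exact: vacuum_eigen_ba.
- rewrite so_gen_last; apply: vacuum_eigen_add => //; apply: vacuum_eigen_opp.
  by apply: vacuum_eigen_scale; exact: vacuum_eigen_one.
Qed.

Lemma cartan_eigen p : monomial_eigen (Phi (p, p)).
Proof.
have [c hc] := vacuum_eigen_cartan p.
exact: (monomial_eigen_weyl hc (cartan_osc p)).
Qed.

Local Notation G := (gibbs a b t s xs ix).

Lemma gibbs_same : gibbs a' b' t' s' xs ix = G.
Proof. by apply: eq_bigr => l _; rewrite cartan_same. Qed.

(** The modulus of the factor by which the eigenvalue of [G] changes under the
    creation operator [j]. *)
Definition gibbs_ratio (j : 'I_n) : R :=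
  expR ((if (j < k)%N then -1 else 1) * (level y (s (mid j)) - level y k)).

Lemma gibbs_ratio_lt1 j : gibbs_ratio j < 1.
Proof.
rewrite /gibbs_ratio -[ltRHS]expR0 ltr_expR; have [jk|kj] := ltnP j k.
  have : level y k < level y (s (mid j)).
    exact: (level_decr y_decr y_gt0 (swap_mid_low hk jk)).
  by rewrite mulN1r oppr_lt0 subr_gt0.
have : level y (s (mid j)) < level y k.
  exact: (level_decr y_decr y_gt0 (swap_mid_high hk kj)).
by rewrite mul1r subr_lt0.
Qed.

Lemma gibbs_decays : decaying_monomial G.
Proof.
pose rho := \big[Num.max/2%:R^-1]_j gibbs_ratio j.
have rho_ge j : gibbs_ratio j <= rho by apply: le_bigmax.
have rho01 : 0 < rho < 1.
  apply/andP; split.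
    by apply: lt_le_trans (bigmax_ge_id _ _ _ _); rewrite invr_gt0.
  by apply: bigmax_lt => [|j _]; [lra|exact: gibbs_ratio_lt1].
have [g hg] : vacuum_eigen G.
  rewrite /gibbs; elim/big_rec: _ => [|l X _ [c hc]]; first exact: vacuum_eigen_one.
  have [h hh] := vacuum_eigen_cartan (ix l); exists (c * expC (h * xs l)).
  by rewrite fe_mulE hc linearZ /= (tau_powE (xs l) (cartan_eigen _) hh) scalerA.
apply: (decaying_diagonal rho01 hg (fun j => prod_tau_pow_comm xs
  (fun l => cartan_eigen (ix l)) (fun l => cartan_osc (ix l) j))) => j.
rewrite cabs_prod_expC; apply: le_trans (rho_ge j); rewrite /gibbs_ratio le_eqVlt.
apply/orP; left; apply/eqP; congr expR.
rewrite /level -sumrB mulr_sumr; apply: eq_bigr => l _.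
by rewrite /osc_weight -mulrBl mulrA.
Qed.

Lemma twist_neq1 i j : i != j -> twist xs ix (i, j) <> 1.
Proof.
move=> ij /(congr1 (@cabs R)); rewrite /twist /=.
under eq_bigr do rewrite !weight_complex -rmorphB.
rewrite cabs_prod_expC (cabs_nat R 1) -[RHS]expR0 => /expR_inj /eqP.
under eq_bigr do rewrite mulrBl.
by rewrite sumrB subr_eq0 eq_sym; apply/negP; exact: (level_inj y_decr y_gt0).
Qed.

(** The formula of [lax_horner] for both terms: the constants [lax_d] agree. *)
Lemma joint_entry (x : C) i j :
  joint Phi Phi' (lax_k t k i j).[x%:A] (lax_k t' (rev_ord k) i j).[x%:A].
Proof.
rewrite lax_low_entry lax_high_entry.
rewrite (horner_family t ccr_low (swap_indexK hk)) (horner_family t' ccr_high dual_swapK).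
have -> : lax_d n t' = lax_d n t by rewrite /lax_d /lax_e -addn2 natrD; field.
apply: joint_add; last by apply: joint_scale; exact: joint_one.
apply: joint_add; apply: joint_scale; last exact: joint_letter.
by apply: joint_sum => m; apply: joint_mul; exact: joint_letter.
Qed.

Lemma T_plus_dual (x : C) :
  T_plus N xs (ix k0) t x = T_plus N xs (rev_ord (ix k0)) t' x.
Proof.
apply/matrixP => I0 J0; rewrite [LHS]mxE [RHS]mxE.
have F1 l : F_gen t k l l = Phi (l, l).
  by rewrite /F_gen lax_low_entry (lax_coef1 _ ccr_low).
have F2 l : F_gen t' (rev_ord k) l l = Phi (l, l).
  by rewrite /F_gen lax_high_entry (lax_coef1 _ ccr_high) -cartan_same.
have G1 : \prod_(l < r) tau_pow (xs l) (F_gen t (ix k0) (ix l) (ix l)) = G.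
  by apply: eq_bigr => l _; rewrite F1.
have G2 : \prod_(l < r) tau_pow (xs l) (F_gen t' (rev_ord (ix k0)) (ix l) (ix l)) = G.
  by apply: eq_bigr => l _; rewrite F2.
apply: (etrans (congr1 (fun Z => fock_trace (Z * _)) G1)).
apply: (etrans _ (esym (congr1 (fun Z => fock_trace (Z * _)) G2))).
have q1 : quasi_commuting G (@so_bracket R n) (twist xs ix) Phi.
  apply: family_quasi_commuting => [||i|j|j|l].
  - exact: ccr_low.
  - exact: (swap_indexK hk).
  - exact: (swap_index_rev hk).
  - by case: (weyl_tw k j).
  - by case: (weyl_tw k j).
  - exact: cartan_eigen.
have q2 : quasi_commuting G (@so_bracket R n) (twist xs ix) Phi'.
  rewrite -gibbs_same; apply: family_quasi_commuting => [||i|j|j|l].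
  - exact: ccr_high.
  - exact: dual_swapK.
  - exact: dual_swap_rev.
  - by case: (weyl_tw (rev_ord k) j).
  - by case: (weyl_tw (rev_ord k) j).
  - by rewrite cartan_same; exact: cartan_eigen.
apply: (joint_gtrace gibbs_decays q1 q2) => [[i j]|].
  have [<-|ij] := eqVneq i j; first by left; rewrite cartan_same.
  by right; exact: twist_neq1.
by apply: joint_prod => m; exact: joint_entry.
Qed.

End Duality.

(** The signs of the terms for [k] and [k'] agree for even [K] and differ for odd
    [K]. *)
Lemma signed_sum_dual (S : pzRingType) (V : lmodType S) (r : nat) (o : bool)
    (f g f' g' : 'I_r -> V) : (forall l, f l = g' l) -> (forall l, g l = f' l) ->
  (if o then \sum_(l < r) (-1) ^+ l *: f l + \sum_(l < r) (-1) ^+ l.+1 *: g l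
   else \sum_(l < r) (-1) ^+ l *: f l + \sum_(l < r) (-1) ^+ l *: g l) =
  (-1) ^+ o *:
  (if o then \sum_(l < r) (-1) ^+ l *: f' l + \sum_(l < r) (-1) ^+ l.+1 *: g' l
   else \sum_(l < r) (-1) ^+ l *: f' l + \sum_(l < r) (-1) ^+ l *: g' l).
Proof.
move=> fg gf; case: o.
  rewrite expr1 scaleN1r opprD addrC -!sumrN; congr (_ + _); apply: eq_bigr => l _.
    by rewrite gf exprS mulN1r scaleNr.
  by rewrite fg exprS mulN1r scaleNr opprK.
rewrite expr0 scale1r addrC; congr (_ + _); apply: eq_bigr => l _.
  by rewrite gf.
by rewrite fg.
Qed.

Theorem proposition7p58 (R : realType) (K N : nat) (hK : (5 <= K)%N)
    (xs : 'I_(K./2) -> R[i])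
    (htau : forall i j : 'I_(K./2), (i < j)%N ->
              `|expC (xs j)| < `|expC (xs i)|)
    (htau1 : forall i : 'I_(K./2), 1 < `|expC (xs i)|) :
  forall t x : R[i],
    T1 N xs t x = (-1) ^+ K *: T1 N xs (2%:R - K%:R - t) x.
Proof.
case: K hK xs htau htau1 => [//|[//|n]] _ xs htau htau1 t x.
have y_decr (l m : 'I_(n.+2./2)) : (l < m)%N -> complex.Re (xs m) < complex.Re (xs l).
  by move=> /htau; rewrite !normC_cabs ltcR !cabs_expC ltr_expR.
have y_gt0 (l : 'I_(n.+2./2)) : 0 < complex.Re (xs l).
  by have := htau1 l; rewrite normC_cabs cabs_expC ltcE /= eqxx -[ltLHS]expR0 ltr_expR.
have dual l u := T_plus_dual N y_decr y_gt0 l u x.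
have dual_t l := dual l t.
have dual' l : T_plus N xs (rev_ord (idx l)) t x = T_plus N xs (idx l) (2%:R - n.+2%:R - t) x.
  have e : 2%:R - n.+2%:R - (2%:R - n.+2%:R - t) = t :> R[i] by ring.
  by have := dual l (2%:R - n.+2%:R - t); rewrite e => /esym.
rewrite -(signr_odd R[i] n.+2).
exact: (signed_sum_dual (odd n.+2) dual_t dual').
Qed.
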